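(* Assume $\frac{\alpha}{\mathsf p}+\frac{\gamma}{\mathsf q}=1$, set $\rho=\alpha/\mathsf p$, let $n\ge1$ and fix an initial state $\eta\in\{0,1\}^{\mathbb Z_{>0}}$ with finitely many particles. There exists a unique function $u:\mathbb R_+\times\mathbb W^n_{\ge1}\to\mathbb R$ which satisfies: (1) for all $\vec x\in\mathbb W^n_{\ge1}$ and $t\in\mathbb R_+$, $\frac{d}{dt}u(t;\vec x)=\mathscr D^{(n,\rho)}u(t;\vec x)$; (2) for any $T>0$ there exist constants $c,C>0$ such that for all $t\in[0,T]$ and $\vec x\in\mathbb W^n_{\ge1}$, $|u(t;\vec x)|\le C\prod_{i=1}^ne^{c|x_i|}$; (3) for any $\vec x\in\mathbb W^n_{\ge1}$, $u(0;\vec x)=H(\eta,\vec x)$. This solution is such that for all $\vec x\in\mathbb W^n_{\ge1}$ and $t\in\mathbb R_+$, $u(t;\vec x)=\mathbb E^\eta[H(\eta(t),\vec x)]$, where $\mathbb E^\eta$ denotes expectation with respect to half-line open ASEP $\eta(t)$ with initial condition $\eta$.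
   Context: Parameters: real numbers $\mathsf p>\mathsf q>0$ and $\alpha,\gamma\ge0$; $q:=\mathsf q/\mathsf p\in(0,1)$. Half-line open ASEP: the continuous time Markov process $\eta(t)$ on $\{0,1\}^{\mathbb Z_{>0}}$ in which, independently, for each $x\ge1$ a particle jumps from $x$ to $x+1$ at rate $\mathsf p\,\eta_x(1-\eta_{x+1})$ and from $x+1$ to $x$ at rate $\mathsf q\,\eta_{x+1}(1-\eta_x)$, a particle is created at site $1$ at rate $\alpha(1-\eta_1)$ and annihilated at site $1$ at rate $\gamma\eta_1$. $N_x(\eta)=\sum_{i\ge x}\eta_i$, $Q_x(\eta)=q^{N_x(\eta)}$, $H(\eta,\vec x)=\prod_{i=1}^nQ_{x_i}(\eta)$. $\mathbb W^n_{\ge1}=\{\vec x\in\mathbb Z^n:1\le x_1<\dots<x_n\}$, $\vec x_i^{\pm}=(x_1,\dots,x_i\pm1,\dots,x_n)$. For $f:\mathbb W^n_{\ge1}\to\mathbb R$, with the convention $x_{n+1}=+\infty$, $$\mathscr D^{(n,\rho)}f(\vec x)=\sum_{\substack{2\le i\le n\\ x_i-x_{i-1}>1}}\mathsf p\big(f(\vec x_i^-)-f(\vec x)\big)+\sum_{\substack{1\le i\le n\\ x_{i+1}-x_i>1}}\mathsf q\big(f(\vec x_i^+)-f(\vec x)\big)+\mathbf 1_{x_1>1}\,\mathsf p\big(f(\vec x_1^-)-f(\vec x)\big)-\mathbf 1_{x_1=1}(\mathsf p-\mathsf q)\rho f(\vec x).$$ *)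

(* Defs.v *)
From HB Require Import structures.
From mathcomp Require Import all_boot all_order all_algebra.
From mathcomp Require Import all_classical all_reals all_analysis.
Set Implicit Arguments.
Unset Strict Implicit.
Unset Printing Implicit Defensive.
Import Order.TTheory GRing.Theory Num.Theory.
Import numFieldNormedType.Exports.
Local Open Scope classical_set_scope.
Local Open Scope ring_scope.

(** * Configurations of particles on the half line {1, 2, 3, ...} *)

(** [{0,1}^{Z_{>0}}] with the product topology.  The occupation variable of
    site [x >= 1] is stored at index [x.-1]; configurations are only read
    through [occ], at sites [x >= 1]. *)
Notation config := cantor_space (only parsing).

Definition occ (eta : config) (x : nat) : bool := eta x.-1.

Definition swap (eta : config) (x : nat) : config := fun i : nat =>
  if i.+1 == x then occ eta x.+1 else if i.+1 == x.+1 then occ eta x else eta i.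

Definition flip1 (eta : config) : config := fun i : nat =>
  if i.+1 == 1%N then ~~ occ eta 1 else eta i.

Definition finitely_many_particles (eta : config) : Prop :=
  finite_set [set x : nat | (0 < x)%N && occ eta x].

(** * Half-line open ASEP *)

Definition local {R : realType} (f : config -> R) : Prop :=
  exists M : nat, forall eta zeta : config,
    (forall x, (1 <= x <= M)%N -> occ eta x = occ zeta x) -> f eta = f zeta.

(** For a local [f] all but finitely many terms of the sum over [x] vanish. *)
Definition asep_L {R : realType} (p q alpha gamma : R) (f : config -> R)
    (eta : config) : R :=
  limn (fun M : nat => \sum_(1 <= x < M)
    (p * (occ eta x && ~~ occ eta x.+1)%:R
       + q * (occ eta x.+1 && ~~ occ eta x)%:R) * (f (swap eta x) - f eta))
  + (alpha * (~~ occ eta 1)%:R + gamma * (occ eta 1)%:R)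
    * (f (flip1 eta) - f eta).

(** A Markov (Feller) semigroup on the space of continuous functions; the values
    of [S] at negative times or at discontinuous functions are irrelevant. *)
Record markov_semigroup {R : realType}
    (S : R -> (config -> R) -> (config -> R)) : Prop := MarkovSemigroup {
  semigroup_continuous : forall (t : R) (f : config -> R), 0 <= t ->
    continuous f -> continuous (S t f) ;
  semigroup0 : forall f : config -> R, continuous f -> S 0 f = f ;
  semigroupD : forall (s t : R) (f : config -> R), 0 <= s -> 0 <= t ->
    continuous f -> S (s + t) f = S s (S t f) ;
  semigroup_linear : forall (t a : R) (f g : config -> R), 0 <= t ->
    continuous f -> continuous g ->
    S t (fun eta => a * f eta + g eta) = (fun eta => a * S t f eta + S t g eta) ;
  semigroup1 : forall t : R, 0 <= t -> S t (fun=> 1) = (fun=> 1) ;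
  semigroup_ge0 : forall (t : R) (f : config -> R), 0 <= t ->
    continuous f ->
    (forall eta, 0 <= f eta) -> forall eta, 0 <= S t f eta ;
  semigroup_strong : forall (f : config -> R) (e : R), continuous f -> 0 < e ->
    \forall h \near (0 : R)^'+, forall eta, `|S h f eta - f eta| <= e
}.

(** [f] is in the domain of the infinitesimal generator of [S], with value [g]. *)
Definition generator {R : realType} (S : R -> (config -> R) -> (config -> R))
    (f g : config -> R) : Prop :=
  continuous f /\ forall e : R, 0 < e ->
    \forall h \near (0 : R)^'+, forall eta, `|h^-1 * (S h f eta - f eta) - g eta| <= e.

(** The graph of the closure (in the uniform norm) of [asep_L] on local
    functions. *)
Definition asep_closure {R : realType} (p q alpha gamma : R)
    (f g : config -> R) : Prop :=
  forall e : R, 0 < e -> exists k : config -> R, local k /\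
    forall eta, `|f eta - k eta| <= e
             /\ `|g eta - asep_L p q alpha gamma k eta| <= e.

Definition asep_semigroup {R : realType} (p q alpha gamma : R)
    (S : R -> (config -> R) -> (config -> R)) : Prop :=
  markov_semigroup S /\
  forall f g : config -> R, generator S f g <-> asep_closure p q alpha gamma f g.

(** Natural filtration of a process [X], at time [s]. *)
Definition past {R : realType} {Omega : Type} (X : R -> Omega -> config) (s : R)
    : set (set Omega) :=
  (<<s [set A | exists r x, [/\ 0 <= r <= s, (1 <= x)%N &
                               A = [set w | occ (X r w) x]]] >>).

(** [X] is a half-line open ASEP started from [eta], under [P]: a right-continuous
    with left limits Markov process with the transition semigroup above. *)
Record asep_process {R : realType} (p q alpha gamma : R) (eta : config)
    (d : measure_display) (Omega : measurableType d) (P : probability Omega R)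
    (X : R -> Omega -> config) : Prop := AsepProcess {
  asep_measurable : forall (t : R) (x : nat), 0 <= t -> (1 <= x)%N ->
    measurable [set w | occ (X t w) x] ;
  asep_right_continuous : forall (w : Omega) (t : R), 0 <= t -> X s w @[s --> t^'+] --> X t w ;
  asep_left_limit : forall (w : Omega) (t : R), 0 < t ->
    exists l : config, X s w @[s --> t^'-] --> l ;
  asep_start : {ae P, forall w, X 0 w = eta} ;
  asep_markov : exists S, asep_semigroup p q alpha gamma S /\
    forall (s t : R) (f : config -> R) (A : set Omega), 0 <= s -> 0 <= t -> continuous f ->
      past X s A ->
      (\int[P]_(w in A) (f (X (s + t) w))%:E
       = \int[P]_(w in A) (S t f (X s w))%:E)%E
}.

(** * The duality functional *)

Definition Ncount (R : realType) (x : nat) (eta : config) : \bar R :=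
  (\sum_(x <= i <oo) ((occ eta i)%:R)%:E)%E.

(** [Qpow q x eta = q ^ Ncount x eta] for [0 < q < 1], with [q ^ +oo = 0]. *)
Definition Qpow {R : realType} (q : R) (x : nat) (eta : config) : R :=
  match Ncount R x eta with r%:E => q `^ r | _ => 0 end.

Definition Hdual {R : realType} (q : R) (n : nat) (eta : config)
    (x : {ffun 'I_n -> nat}) : R :=
  \prod_(i < n) Qpow q (x i) eta.

(** * The evolution equation on the half-line Weyl chamber *)

(** Coordinates [x_1 < ... < x_n] are indexed by ['I_n], i.e. [x_i] is the
    value at the ordinal [i - 1]. *)
Definition weyl (n : nat) (x : {ffun 'I_n -> nat}) : Prop :=
  (forall i, (1 <= x i)%N) /\ (forall i j : 'I_n, (i < j)%N -> (x i < x j)%N).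

Definition up (n : nat) (x : {ffun 'I_n -> nat}) (i : 'I_n)
    : {ffun 'I_n -> nat} := [ffun j => if j == i then (x j).+1 else x j].
Definition down (n : nat) (x : {ffun 'I_n -> nat}) (i : 'I_n)
    : {ffun 'I_n -> nat} := [ffun j => if j == i then (x j).-1 else x j].

(** [x_i - x_{i-1} > 1]; vacuous for the first coordinate. *)
Definition left_gap (n : nat) (x : {ffun 'I_n -> nat}) (i : 'I_n) : bool :=
  [forall j : 'I_n, (j.+1 == i :> nat) ==> ((x j).+1 < x i)%N].
(** [x_{i+1} - x_i > 1]; vacuous for the last coordinate ([x_{n+1} = +oo]). *)
Definition right_gap (n : nat) (x : {ffun 'I_n -> nat}) (i : 'I_n) : bool :=
  [forall j : 'I_n, (j == i.+1 :> nat) ==> ((x i).+1 < x j)%N].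

(** The sum over [i] with [i == 0] has the single term of the coordinate [x_1]. *)
Definition Dgen {R : realType} (p q rho : R) (n : nat)
    (f : {ffun 'I_n -> nat} -> R) (x : {ffun 'I_n -> nat}) : R :=
  \sum_(i < n | (0 < i)%N && left_gap x i) p * (f (down x i) - f x)
  + \sum_(i < n | right_gap x i) q * (f (up x i) - f x)
  + \sum_(i < n | i == 0%N :> nat)
      ((1 < x i)%N%:R * (p * (f (down x i) - f x))
       - (x i == 1%N)%:R * ((p - q) * rho * f x)).

(** [f] has derivative [l] at [t] relative to [0, +oo) (one-sided at [t = 0]). *)
Definition derive_nonneg {R : realType} (f : R -> R) (t l : R) : Prop :=
  (fun h : R => h^-1 * (f (t + h) - f t))
    @ within [set h | 0 <= t + h] (0 : R)^' --> l.

(** Functions on [R_+ * W^n_{>=1}] are represented by total functions, of which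
    only the values at [t >= 0] and [weyl x] matter. *)
Record solution {R : realType} (p q rho : R) (n : nat) (eta : config)
    (u : R -> {ffun 'I_n -> nat} -> R) : Prop := Solution {
  solution_evolution : forall x t, weyl x -> 0 <= t ->
    derive_nonneg (fun s => u s x) t (Dgen p q rho (u t) x) ;
  solution_growth : forall T, 0 < T -> exists c C : R, [/\ 0 < c, 0 < C &
    forall t x, 0 <= t <= T -> weyl x ->
      `|u t x| <= C * \prod_(i < n) expR (c * (x i)%:R)] ;
  solution_initial : forall x, weyl x -> u 0 x = Hdual (q / p) eta x
}.

(* Main.v *)
(** The operator [Dgen] is bounded, both in the uniform norm and in the norm
    weighted by [prod_i exp (c x_i)].  Hence [exp (t Dgen)] applied to
    [Hdual q eta] is a solution, and iterating the integral form of the equation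
    shows that it is the only one in the growth class.

    [Hdual] is not continuous on the configuration space, so the Feller semigroup
    is applied to its truncations to the sites [<= L].  On these the generator of
    ASEP agrees with [Dgen] up to an error supported on the configurations
    occupying [L] or [L + 1]: away from the end points each [x_i] contributes
    [(p - q) (eta_(x_i) - eta_(x_i - 1)) H] on both sides, adjacent coordinates
    telescope, and Liggett's condition matches the boundary terms.  Starting from
    finitely many particles, the probability that a site at distance [k] beyond
    the rightmost one is occupied at time [t] is at most
    [((p + q) t)^k / k!], so the error vanishes as [L] tends to infinity and the
    perturbed evolution equation identifies the limit. *)

Require Import Defs.
From HB Require Import structures.
From mathcomp Require Import all_boot all_order all_algebra.
From mathcomp Require Import all_classical all_reals all_analysis.
From mathcomp Require Import measurable_realfun ring lra.
Set Implicit Arguments.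
Unset Strict Implicit.
Unset Printing Implicit Defensive.
Import Order.TTheory GRing.Theory Num.Theory.
Import numFieldNormedType.Exports.
Local Open Scope classical_set_scope.
Local Open Scope ring_scope.

(* [down] would otherwise denote the homonymous operation on sets. *)
Local Notation down := Defs.down.

(** * One-sided derivatives and a Gronwall bound *)

Lemma derive_nonnegP (R : realType) (f : R -> R) (t l : R) :
  derive_nonneg f t l <->
  forall e, 0 < e -> exists2 d, 0 < d & forall h, `|h| < d -> h != 0 ->
    0 <= t + h -> `|h^-1 * (f (t + h) - f t) - l| <= e.
Proof.
split=> [fl e e0|fl].
- move/cvgrPdist_le: fl => /(_ e e0); rewrite /within /dnbhs /within /=.
  move/nbhs_ballP => -[d /= d0 fd]; exists d => // h hd h0 th.
  by rewrite distrC; apply: fd => //; rewrite /ball/= sub0r normrN.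
- apply/cvgrPdist_le => e e0; have [d d0 fd] := fl e e0.
  apply/nbhs_ballP; exists d => //= h; rewrite /ball/= sub0r normrN => hd h0 th.
  by rewrite distrC; apply: fd.
Qed.

Lemma derive_nonneg_is_derive (R : realType) (f : R -> R) (t l : R) :
  0 < t -> derive_nonneg f t l -> is_derive t 1 f l.
Proof.
move=> t0 /derive_nonnegP fl.
suff fcvg : h^-1 *: (f (h *: 1 + t) - f t) @[h --> 0^'] --> l.
  by apply: DeriveDef; [exact: cvgP fcvg | exact: cvg_lim].
apply/cvgrPdist_le => e e0; have [d d0 fd] := fl e e0.
(* A radius of at most [t] keeps [t + h] nonnegative. *)
apply/nbhs_ballP; exists (Num.min d t); first by rewrite /= lt_min d0.
move=> h; rewrite /ball/= sub0r normrN lt_min => /andP[hd ht] h0.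
rewrite distrC [h *: 1]mulr1 [h + t]addrC; apply: fd => //.
by move: ht; rewrite ltr_norml => /andP[? _]; lra.
Qed.

Lemma is_derive_derive_nonneg (R : realType) (f : R -> R) (t l : R) :
  is_derive t 1 f l -> derive_nonneg f t l.
Proof.
move=> [df fE]; apply/derive_nonnegP => e e0.
move: df; rewrite /derivable -/(derive f t 1) => df.
have : h^-1 *: (f (h *: 1 + t) - f t) @[h --> 0^'] --> l by rewrite -fE.
move/cvgrPdist_le => /(_ e e0) /nbhs_ballP[d /= d0 fd]; exists d => // h hd h0 _.
have := fd h; rewrite /ball/= sub0r normrN => /(_ hd h0).
by rewrite distrC [h *: 1]mulr1 [h + t]addrC.
Qed.

Lemma derive_nonnegD (R : realType) (f g : R -> R) (t l m : R) :
  derive_nonneg f t l -> derive_nonneg g t m ->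
  derive_nonneg (fun s => f s + g s) t (l + m).
Proof.
move=> fl gm; rewrite /derive_nonneg.
have -> : (fun h => h^-1 * (f (t + h) + g (t + h) - (f t + g t))) =
  (fun h => h^-1 * (f (t + h) - f t) + h^-1 * (g (t + h) - g t)).
  by apply/funext => h; ring.
exact: cvgD.
Qed.

Lemma derive_nonnegZ (R : realType) (a : R) (f : R -> R) (t l : R) :
  derive_nonneg f t l -> derive_nonneg (fun s => a * f s) t (a * l).
Proof.
move=> fl; rewrite /derive_nonneg.
have -> : (fun h => h^-1 * (a * f (t + h) - a * f t)) =
  (fun h => a * (h^-1 * (f (t + h) - f t))).
  by apply/funext => h; ring.
exact: cvgMr.
Qed.

Lemma derive_nonnegB (R : realType) (f g : R -> R) (t l m : R) :
  derive_nonneg f t l -> derive_nonneg g t m ->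
  derive_nonneg (fun s => f s - g s) t (l - m).
Proof.
move=> fl gm; have := derive_nonnegD fl (derive_nonnegZ (a := -1) gm).
by rewrite mulN1r; congr derive_nonneg; apply/funext => s; rewrite mulN1r.
Qed.

Lemma derive_nonneg_right_continuous (R : realType) (f : R -> R) (t l : R) :
  0 <= t -> derive_nonneg f t l -> f @ t^'+ --> f t.
Proof.
move=> t0 /derive_nonnegP fl; apply/cvgrPdist_le => e e0.
have [d d0 fd] := fl 1 ltr01.
have l1 : 0 < `|l| + 1 by rewrite ltr_wpDl.
(* Near [t] the difference quotient is within 1 of [l], so [f] moves by at most [|l| + 1] times the
   distance. *)
pose d' := Num.min d (e / (`|l| + 1)).
have d'0 : 0 < d' by rewrite lt_min d0 divr_gt0.
apply/nbhs_ballP; exists d' => //= y; rewrite /ball/= distrC => yt ty.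
have := fd (y - t).
rewrite subr_eq0 gt_eqF//= [t + _]addrC subrK (le_trans t0 (ltW ty)).
move: yt; rewrite lt_min => /andP[yd ye] /(_ yd isT isT) fyt.
have yt0 : 0 < y - t by rewrite subr_gt0.
have : `|(y - t)^-1 * (f y - f t)| <= `|l| + 1.
  rewrite -[X in `|X|](subrK l) addrC (le_trans (ler_normD _ _))//.
  by rewrite lerD2l.
rewrite normrM normfV ler_pdivrMl ?normr_gt0 ?gt_eqF// distrC => /le_trans; apply.
by rewrite mulrC -ler_pdivlMl// mulrC ltW.
Qed.

(* Only nonnegative times are visible to [derive_nonneg], so the
   mean value theorem is applied on [0, T]. *)
Lemma derive_nonneg_le0 (R : realType) (f df : R -> R) (T : R) : 0 <= T ->
  (forall t, 0 <= t <= T -> derive_nonneg f t (df t)) ->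
  (forall t, 0 <= t <= T -> df t <= 0) -> f T <= f 0.
Proof.
rewrite le_eqVlt => /orP[/eqP<-//|T0] fdf df0.
have fd t : t \in `]0, T[ -> is_derive t 1 f (df t).
  by rewrite in_itv/= => /andP[t0 tT]; apply/derive_nonneg_is_derive/fdf => //; rewrite !ltW.
have fc : {within `[0, T], continuous f}.
  apply/continuous_within_itvP => //; split.
  - move=> t /fd [ft _]; exact/differentiable_continuous/derivable1_diffP.
  - by apply: derive_nonneg_right_continuous (fdf 0 _); rewrite ?lexx ?ltW.
  - apply: cvg_at_left_filter; have [] : is_derive T 1 f (df T).
      by apply/derive_nonneg_is_derive/fdf => //; rewrite lexx ltW.
    by move=> ft _; exact/differentiable_continuous/derivable1_diffP.
have [t] := MVT T0 fd fc; rewrite in_itv/= => /andP[t0 tT] fE.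
rewrite -subr_le0 fE subr0; apply: mulr_le0_ge0; last exact: ltW.
by apply: df0; rewrite !ltW.
Qed.

Lemma derive_nonneg_le (R : realType) (f df g dg : R -> R) (T : R) :
  (forall t, 0 <= t <= T -> derive_nonneg f t (df t)) ->
  (forall t, 0 <= t <= T -> derive_nonneg g t (dg t)) ->
  (forall t, 0 <= t <= T -> df t <= dg t) -> f 0 <= g 0 ->
  forall t, 0 <= t <= T -> f t <= g t.
Proof.
move=> fdf gdg dfg fg0 t /andP[t0 tT].
rewrite -subr_le0; have fg0' : f 0 - g 0 <= 0 by rewrite subr_le0.
apply: le_trans fg0'; pose df' s := df s - dg s.
have sT s : 0 <= s <= t -> 0 <= s <= T.
  by move=> /andP[-> st]; exact: le_trans st tT.
apply: (@derive_nonneg_le0 _ (fun s => f s - g s) df') => // s /sT s0T.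
- by apply: derive_nonnegB; [exact: fdf | exact: gdg].
- by rewrite /df' subr_le0 dfg.
Qed.

(** Integrating [K] times one term of the exponential series gives the next term, so one round of
    integrating a bound raises [k] by one. *)
Lemma derive_nonneg_expr_fact (R : realType) (K t : R) (k : nat) :
  derive_nonneg (fun s => (K * s) ^+ k.+1 / k.+1`!%:R) t (K * ((K * t) ^+ k / k`!%:R)).
Proof.
apply: is_derive_derive_nonneg.
have -> : (fun s => (K * s) ^+ k.+1 / k.+1`!%:R) =
    (K ^+ k.+1 / k.+1`!%:R) *: (@GRing.exp R ^~ k.+1).
  by apply/funext => s; rewrite /= exprMn mulrAC.
have dX : is_derive t (1 : R) (@GRing.exp R ^~ k.+1) (k.+1%:R *: t ^+ k).
  apply: DeriveDef; first exact: exprn_derivable.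
  by rewrite exp_derive /= [LHS]mulr1.
apply: is_derive_eq.
rewrite factS natrM /GRing.scale/= exprS exprMn; field.
by rewrite pnatr_eq0 -lt0n fact_gt0 /= addrC natr1 pnatr_eq0.
Qed.

Lemma derive_nonneg_expR (R : realType) (K t : R) :
  derive_nonneg (fun s => expR (K * s)) t (K * expR (K * t)).
Proof.
apply: is_derive_derive_nonneg.
have dK : is_derive t (1 : R) ( *%R K) K.
  have -> : *%R K = K *: @id R by [].
  by apply: is_derive_eq; rewrite [LHS]mulr1.
have := @is_derive1_comp R expR ( *%R K) t _ _ (is_derive_expR _) dK.
by rewrite (mulrC K (expR _)).
Qed.

Lemma derive_nonneg_cst (R : realType) (c t : R) : derive_nonneg (fun=> c) t 0.
Proof. by apply: is_derive_derive_nonneg; exact: is_derive_cst. Qed.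

Lemma cvg_expr_fact (R : realType) (x : R) : x ^+ k / k`!%:R @[k --> \oo] --> (0 : R).
Proof. exact: cvg_series_cvg_0 (is_cvg_series_exp_coeff x). Qed.

(* A weighted Gronwall bound for infinite systems: the a priori bound [M] is
   improved by iterating the integral inequality, giving the factor
   [M * (K t)^k / k!] after [k] steps. *)
Lemma gronwall_system (R : realType) (I : Type) (P : I -> Prop) (W : I -> R)
    (w dw : R -> I -> R) (K M eps T : R) : 0 < K ->
  0 <= M -> 0 <= eps -> (forall i, P i -> 0 <= W i) ->
  (forall t i, 0 <= t <= T -> P i -> derive_nonneg (w ^~ i) t (dw t i)) ->
  (forall t B, 0 <= t <= T -> 0 <= B ->
    (forall i, P i -> `|w t i| <= B * W i) ->
    forall i, P i -> `|dw t i| <= (K * B + eps) * W i) ->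
  (forall t i, 0 <= t <= T -> P i -> `|w t i| <= M * W i) ->
  (forall i, P i -> w 0 i = 0) ->
  forall t i, 0 <= t <= T -> P i ->
    `|w t i| <= eps / K * (expR (K * t) - 1) * W i.
Proof.
move=> K0 M0 e0 W0 wdw dwle wM w0 t i t0T Pi.
(* The second summand solves [b' = K b + eps] with [b 0 = 0], so each round of iteration reproduces
   it, while the first summand becomes factorially small. *)
pose B k s := M * ((K * s) ^+ k / k`!%:R) + eps / K * (expR (K * s) - 1).
pose dB k s := M * (K * ((K * s) ^+ k / k`!%:R)) + eps / K * (K * expR (K * s) - 0).
have B0 k s : 0 <= s -> 0 <= B k s.
  move=> s0; have Ks : 0 <= K * s by rewrite mulr_ge0// ltW.
  rewrite addr_ge0// mulr_ge0//; first by rewrite divr_ge0// exprn_ge0.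
    by rewrite divr_ge0// ltW.
  by rewrite subr_ge0 -expR0 ler_expR.
have dBE k s : dB k s = K * B k s + eps.
  by rewrite /dB /B; field; rewrite gt_eqF// pnatr_eq0 -lt0n fact_gt0.
have BdB k s : derive_nonneg (B k.+1) s (dB k s).
  apply: derive_nonnegD; apply: derive_nonnegZ.
    exact: derive_nonneg_expr_fact.
  by apply: derive_nonnegB; [exact: derive_nonneg_expR | exact: derive_nonneg_cst].
have main k : forall s j, 0 <= s <= T -> P j -> `|w s j| <= B k s * W j.
  elim: k => [|k IH] s j sT Pj.
    rewrite (le_trans (wM _ _ sT Pj))// ler_wpM2r ?W0// /B expr0 fact0 divr1 mulr1.
    case/andP: sT => s0 _; rewrite lerDl mulr_ge0//.
      by rewrite divr_ge0// ltW.
    by rewrite subr_ge0 -expR0 ler_expR mulr_ge0// ltW.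
  have dle r : 0 <= r <= T -> `|dw r j| <= W j * dB k r.
    move=> rT; rewrite dBE mulrC; apply: dwle => //; last by move=> *; exact: IH.
    by case/andP: rT => r0 _; exact: B0.
  have B00 : W j * B k.+1 0 = 0.
    by rewrite /B mulr0 expr0n/= mul0r expR0 subrr !mulr0 addr0 mulr0.
  have wB : w s j <= W j * B k.+1 s.
    apply: (@derive_nonneg_le _ (w ^~ j) (dw ^~ j)
        (fun r => W j * B k.+1 r) (fun r => W j * dB k r) T) => //.
    - by move=> r rT; exact: wdw.
    - by move=> r rT; exact: derive_nonnegZ.
    - by move=> r /dle; rewrite ler_norml => /andP[].
    - by rewrite w0// B00.
  (* The lower bound is the same comparison applied to [- w]. *)
  have wB' : -1 * w s j <= W j * B k.+1 s.
    apply: (@derive_nonneg_le _ (fun r => -1 * w r j) (fun r => -1 * dw r j)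
        (fun r => W j * B k.+1 r) (fun r => W j * dB k r) T) => //.
    - by move=> r rT; apply: derive_nonnegZ; exact: wdw.
    - by move=> r rT; exact: derive_nonnegZ.
    - by move=> r /dle; rewrite mulN1r ler_norml lerNl => /andP[].
    - by rewrite w0// B00 mulr0.
  by rewrite mulrC ler_norml wB -lerNl -mulN1r wB'.
(* Letting [k] tend to infinity removes the a priori bound [M]. *)
have cvgB : B k t * W i @[k --> \oo] --> (M * 0 + eps / K * (expR (K * t) - 1)) * W i.
  apply: cvgMl; apply: cvgD; last exact: cvg_cst.
  by apply: cvgMr; exact: cvg_expr_fact.
rewrite mulr0 add0r in cvgB.
apply: (cvgr_to_ge cvgB); apply: nearW => k; exact: main.
Qed.

(** * The operator Dgen *)

Section linear_combinations.
Variables (R : realType) (I : Type).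

(** A finite combination of point evaluations is linear, passes to pointwise limits and commutes
    with a Markov semigroup. [Dgen] at a fixed point has this form, and all three properties are
    used for it. *)
Definition is_combination (L : (I -> R) -> R) : Prop :=
  exists s : seq (R * I), forall f, L f = \sum_(j <- s) j.1 * f j.2.

Lemma is_combination0 : is_combination (fun=> 0).
Proof. by exists [::] => f; rewrite big_nil. Qed.

Lemma is_combination_eval i : is_combination (fun f => f i).
Proof. by exists [:: (1, i)] => f; rewrite big_seq1 mul1r. Qed.

Lemma is_combinationD L M : is_combination L -> is_combination M ->
  is_combination (fun f => L f + M f).
Proof. by move=> [s Ls] [r Mr]; exists (s ++ r) => f; rewrite big_cat Ls Mr. Qed.

Lemma is_combinationZ a L : is_combination L -> is_combination (fun f => a * L f).
Proof.
move=> [s Ls]; exists [seq (a * j.1, j.2) | j <- s] => f.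
by rewrite Ls big_map mulr_sumr; apply: eq_bigr => j _; rewrite mulrA.
Qed.

Lemma is_combinationB L M : is_combination L -> is_combination M ->
  is_combination (fun f => L f - M f).
Proof.
move=> Lc Mc; have [s Ls] := is_combinationD Lc (is_combinationZ (-1) Mc).
by exists s => f; rewrite -Ls mulN1r.
Qed.

Lemma is_combination_sum (J : Type) (r : seq J) (P : pred J) (L : J -> (I -> R) -> R) :
  (forall j, is_combination (L j)) ->
  is_combination (fun f => \sum_(j <- r | P j) L j f).
Proof.
move=> Lc; elim: r => [|j r IH].
  by have [s Ls] := is_combination0; exists s => f; rewrite big_nil -Ls.
case: (boolP (P j)) => Pj.
  have [s Ls] := is_combinationD (Lc j) IH.
  by exists s => f; rewrite big_cons Pj Ls.
by case: IH => s Ls; exists s => f; rewrite big_cons (negbTE Pj).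
Qed.

Lemma is_combination_linear L a f g : is_combination L ->
  L (fun i => a * f i + g i) = a * L f + L g.
Proof.
move=> [s Ls]; rewrite !Ls mulr_sumr -big_split/=.
by apply: eq_bigr => j _; ring.
Qed.

Lemma is_combination_cvg L (f : nat -> I -> R) (g : I -> R) : is_combination L ->
  (forall i, f k i @[k --> \oo] --> g i) -> L (f k) @[k --> \oo] --> L g.
Proof.
move=> [s Ls] fg; rewrite Ls.
have -> : (fun k => L (f k)) = (fun k => \sum_(j <- s) j.1 * f k j.2).
  by apply/funext => k.
elim: s {Ls} => [|j s IH].
  by under eq_fun do rewrite big_nil; rewrite big_nil; exact: cvg_cst.
under eq_fun do rewrite big_cons.
by rewrite big_cons; apply: cvgD => //; apply: cvgMr; exact: fg.
Qed.

End linear_combinations.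

Lemma norm_sum_le (R : realType) (n : nat) (P : pred 'I_n) (F : 'I_n -> R) (c : R) :
  0 <= c -> (forall i, P i -> `|F i| <= c) -> `|\sum_(i < n | P i) F i| <= n%:R * c.
Proof.
move=> c0 Fc; apply: le_trans (ler_norm_sum _ _ _) _.
apply: (@le_trans _ _ (\sum_(i < n) c)); last first.
  by rewrite sumr_const card_ord mulr_natl.
rewrite big_mkcond/=; apply: ler_sum => i _; case: ifPn => // Pi; exact: Fc.
Qed.

(** * Stability of the Weyl chamber under the moves of [Dgen] *)

Section weyl_chamber.
Variable n : nat.
Implicit Types (x : {ffun 'I_n -> nat}) (i : 'I_n).

(** Only the next coordinate can be hit; those further right are larger still. *)
Lemma weyl_up x i : weyl x -> right_gap x i -> weyl (up x i).
Proof.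
move=> [x1 xlt] /forallP gap; split=> [j|j k jk]; rewrite !ffunE.
  by case: ifP => // _; exact: ltnW (x1 j).
case: eqVneq => [ji|ji]; case: eqVneq => [ki|ki].
- by rewrite ji ki ltnn in jk.
- rewrite ji in jk *.
  have i1n : (i.+1 < n)%N by apply: leq_ltn_trans jk (ltn_ord k).
  have := gap (Ordinal i1n); rewrite /= eqxx /= => xi.
  have [k1|k1] := eqVneq (k : nat) i.+1.
    by rewrite (_ : k = Ordinal i1n)//; exact: val_inj.
  by apply: leq_trans xi (ltnW (xlt (Ordinal i1n) k _)); rewrite /= ltn_neqAle eq_sym k1.
- by rewrite ltnS ltnW// xlt.
- exact: xlt.
Qed.

(** The disjunction joins the two situations in which [Dgen] lowers a coordinate: an inner
    coordinate with a gap, or the first one away from site 1. *)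
Lemma weyl_down x i : weyl x ->
  (0 < i)%N && left_gap x i || (i == 0%N :> nat) && (1 < x i)%N ->
  weyl (down x i).
Proof.
move=> [x1 xlt] gap; have below (j : 'I_n) : (j < i)%N -> (x j < (x i).-1)%N.
  move=> ji; case/orP: gap => /andP[]; last by move=> /eqP i0; rewrite i0 in ji.
  move=> i0 /forallP gap.
  have i1n : (i.-1 < n)%N by apply: leq_ltn_trans (leq_pred _) (ltn_ord i).
  have := gap (Ordinal i1n); rewrite /= prednK// eqxx /= => xi.
  have [j1|j1] := eqVneq (j : nat) i.-1.
    have -> : j = Ordinal i1n by exact: val_inj.
    by rewrite -ltnS (ltn_predK xi).
  apply: (@leq_ltn_trans (x (Ordinal i1n))); last by rewrite -ltnS (ltn_predK xi).
  by rewrite ltnW// xlt//= ltn_neqAle j1/= -ltnS prednK.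
split=> [j|j k jk]; rewrite !ffunE.
  case: eqVneq => // ->; case/orP: gap => /andP[]; last by case: (x i) => [|[]].
  move=> i0 _; have i1n : (0 < n)%N by apply: leq_ltn_trans _ (ltn_ord i).
  by apply: leq_ltn_trans _ (below (Ordinal i1n) i0).
case: eqVneq => [ji|ji]; case: eqVneq => [ki|ki].
- by rewrite ji ki ltnn in jk.
- by rewrite (leq_ltn_trans (leq_pred _))// xlt.
- by rewrite ki in jk *; exact: below.
- exact: xlt.
Qed.

End weyl_chamber.

(** * Weighted bounds on [Dgen] and uniqueness *)

Section generator_bounds.
Variables (R : realType) (p q rho : R) (n : nat).
Hypotheses (p0 : 0 <= p) (q0 : 0 <= q).
Implicit Types (x y : {ffun 'I_n -> nat}) (f g : {ffun 'I_n -> nat} -> R).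

Lemma Dgen_combination x : is_combination (fun f => Dgen p q rho f x).
Proof.
rewrite /Dgen; apply: is_combinationD; last first.
  apply: is_combination_sum => i; apply: is_combinationB.
    do 2 apply: is_combinationZ.
    by apply: is_combinationB; exact: is_combination_eval.
  do 2 apply: is_combinationZ; exact: is_combination_eval.
by apply: is_combinationD; apply: is_combination_sum => i;
  apply: is_combinationZ; apply: is_combinationB; exact: is_combination_eval.
Qed.

Lemma DgenB f g x :
  Dgen p q rho (fun y => f y - g y) x = Dgen p q rho f x - Dgen p q rho g x.
Proof.
have := is_combination_linear (-1) g f (Dgen_combination x); rewrite mulN1r addrC => <-.
by congr Dgen; apply/funext => y; rewrite mulN1r addrC.
Qed.

(** Per coordinate, each difference costs twice its rate and the boundary term costs
    [|(p - q) * rho|]. The final 1 makes the constant positive also for [n = 0], since the Gronwall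
    bound divides by it. *)
Definition Dgen_norm : R :=
  n%:R * (p * 2 + q * 2 + (p * 2 + `|(p - q) * rho|)) + 1.

Lemma Dgen_norm_gt0 : 0 < Dgen_norm.
Proof.
by rewrite ltr_wpDl// mulr_ge0//; do ?[apply: addr_ge0 | apply: mulr_ge0].
Qed.

(** Only the values that [Dgen] reads are assumed bounded, so the estimate serves both globally
    bounded functions and functions controlled on the chamber alone. *)
Lemma Dgen_le f x (B : R) : `|f x| <= B ->
  (forall i : 'I_n, (0 < i)%N && left_gap x i || (i == 0%N :> nat) && (1 < x i)%N ->
     `|f (down x i)| <= B) ->
  (forall i, right_gap x i -> `|f (up x i)| <= B) ->
  `|Dgen p q rho f x| <= Dgen_norm * B.
Proof.
move=> fx fdown fup; have B0 : 0 <= B := le_trans (normr_ge0 _) fx.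
have diff (a : R) y : 0 <= a -> `|f y| <= B -> `|a * (f y - f x)| <= a * 2 * B.
  move=> a0 fy; rewrite normrM (ger0_norm a0) -mulrA ler_wpM2l//.
  by rewrite (le_trans (ler_normB _ _))// mulrDl mul1r lerD.
rewrite /Dgen_norm mulrDl mul1r; apply: ler_wpDr => //.
have -> : n%:R * (p * 2 + q * 2 + (p * 2 + `|(p - q) * rho|)) * B =
  n%:R * (p * 2 * B) + n%:R * (q * 2 * B) +
  n%:R * (p * 2 * B + `|(p - q) * rho| * B) by ring.
apply: le_trans (ler_normD _ _) _; rewrite lerD//.
  apply: le_trans (ler_normD _ _) _; rewrite lerD//.
    apply: norm_sum_le; first by rewrite !mulr_ge0.
    by move=> i gap; apply: diff => //; apply: fdown; rewrite gap.
  apply: norm_sum_le; first by rewrite !mulr_ge0.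
  by move=> i gap; apply: diff => //; exact: fup.
apply: norm_sum_le; first by rewrite addr_ge0 ?mulr_ge0.
move=> i i0; apply: le_trans (ler_normB _ _) _; rewrite lerD//.
  case: (boolP (1 < x i)%N) => xi; last by rewrite mul0r normr0 !mulr_ge0.
  by rewrite mul1r diff// fdown// i0 xi orbT.
case: (x i == 1%N); last by rewrite mul0r normr0 !mulr_ge0.
by rewrite mul1r normrM ler_wpM2l.
Qed.

Definition weight (c : R) x : R := \prod_(i < n) expR (c * (x i)%:R).

Lemma weight_ge0 c x : 0 <= weight c x.
Proof. by apply: prodr_ge0 => i _; exact: expR_ge0. Qed.

Lemma weight_ge1 c x : 0 <= c -> 1 <= weight c x.
Proof.
move=> c0; rewrite /weight; elim/big_ind: _ => //.
  by move=> y z; exact: mulr_ege1.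
by move=> i _; rewrite -expR0 ler_expR mulr_ge0.
Qed.

Lemma weight_up c x i : weight c (up x i) = expR c * weight c x.
Proof.
rewrite /weight (bigD1 i)//= [in RHS](bigD1 i)//= mulrA ffunE eqxx -expRD.
rewrite -natr1 mulrDr mulr1 addrC; congr (_ * _).
by apply: eq_bigr => j ji; rewrite ffunE (negbTE ji).
Qed.

Lemma weight_down c x i : 0 <= c -> weight c (down x i) <= weight c x.
Proof.
move=> c0; apply: ler_prod => j _; rewrite expR_ge0 ler_expR ler_wpM2l//.
by rewrite ler_nat ffunE; case: ifP => // _; exact: leq_pred.
Qed.

(** Moving down does not increase the weight and moving up multiplies it by [expR c], so passing to
    the weighted norm costs only that factor. *)
Lemma Dgen_weight_le c f (B : R) : 0 <= c -> 0 <= B ->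
  (forall x, weyl x -> `|f x| <= B * weight c x) ->
  forall x, weyl x -> `|Dgen p q rho f x| <= Dgen_norm * expR c * B * weight c x.
Proof.
move=> c0 B0 fB x wx; rewrite -!mulrA; have W0 := weight_ge0 c x.
have ec : B * weight c x <= expR c * (B * weight c x).
  by rewrite ler_peMl ?mulr_ge0// -expR0 ler_expR.
apply: Dgen_le => [|i gap|i gap].
- exact: le_trans (fB _ wx) ec.
- apply: le_trans (fB _ (weyl_down wx gap)) _; apply: le_trans ec.
  by rewrite ler_wpM2l// weight_down.
- by apply: le_trans (fB _ (weyl_up wx gap)) _; rewrite weight_up mulrCA.
Qed.

(** The Gronwall bound on the chamber; a uniform error is absorbed because the weight is at least 1.
    It yields uniqueness when [eps = 0] and the removal of the truncation when [eps] tends to 0. *)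
Lemma evolution_perturbation (w err : R -> {ffun 'I_n -> nat} -> R) (c M eps T : R) :
  0 <= c -> 0 <= M -> 0 <= eps ->
  (forall t x, 0 <= t <= T -> weyl x ->
     derive_nonneg (w ^~ x) t (Dgen p q rho (w t) x + err t x)) ->
  (forall t x, 0 <= t <= T -> weyl x -> `|err t x| <= eps) ->
  (forall t x, 0 <= t <= T -> weyl x -> `|w t x| <= M * weight c x) ->
  (forall x, weyl x -> w 0 x = 0) ->
  let K := Dgen_norm * expR c in
  forall t x, 0 <= t <= T -> weyl x ->
    `|w t x| <= eps / K * (expR (K * t) - 1) * weight c x.
Proof.
move=> c0 M0 e0 wd errle wM w0 K; apply: gronwall_system wd _ wM w0 => //.
- by rewrite mulr_gt0 ?Dgen_norm_gt0 ?expR_gt0.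
- by move=> x _; exact: weight_ge0.
- move=> t B tT B0 wB x wx; rewrite mulrDl; apply: le_trans (ler_normD _ _) _.
  rewrite lerD ?Dgen_weight_le//; apply: le_trans (errle _ _ tT wx) _.
  by rewrite ler_peMr// weight_ge1.
Qed.

Lemma solution_unique (eta : config) u v : solution p q rho eta u ->
  solution p q rho eta v -> forall t x, 0 <= t -> weyl x -> v t x = u t x.
Proof.
move=> [ud ug u0] [vd vg v0] t x t0 wx.
(* The growth condition asks for a positive horizon, while [t] may be 0. *)
have T0 : 0 < t + 1 by rewrite ltr_wpDl.
have [c [C [c0 C0 uC]]] := ug _ T0; have [c' [C' [c'0 C'0 vC]]] := vg _ T0.
(* The two solutions come with their own exponents; the larger one serves both. *)
pose m := Num.max c c'.
have mono y d : d <= m -> weight d y <= weight m y.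
  move=> dm; apply: ler_prod => i _; rewrite expR_ge0 ler_expR ler_wpM2r//.
have m0 : 0 <= m by rewrite le_max !ltW.
have wle s y : 0 <= s <= t + 1 -> weyl y ->
    `|v s y - u s y| <= (C + C') * weight m y.
  move=> sT wy; rewrite (le_trans (ler_normB _ _))// addrC mulrDl lerD//.
    apply: le_trans (uC _ _ sT wy) _; rewrite ler_wpM2l ?(ltW C0)//.
    by rewrite -/(weight c y) mono// le_max lexx.
  apply: le_trans (vC _ _ sT wy) _; rewrite ler_wpM2l ?(ltW C'0)//.
  by rewrite -/(weight c' y) mono// le_max lexx orbT.
(* The difference solves the equation without error, so the perturbation bound is 0. *)
have := @evolution_perturbation (fun s y => v s y - u s y) (fun _ _ => 0) m (C + C') 0 (t + 1)
  m0 (ltW (addr_gt0 C0 C'0)) (lexx 0) _ _ wle _ t x _ wx.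
rewrite /= !mul0r => h; apply/eqP; rewrite -subr_eq0 -normr_le0; apply: h.
- move=> s y /andP[s0 _] wy; rewrite addr0 DgenB.
  by apply: derive_nonnegB; [exact: vd | exact: ud].
- by move=> *; rewrite normr0.
- by move=> y wy; rewrite v0// u0// subrr.
- by rewrite t0 lerDl ler01.
Qed.

End generator_bounds.

(** * Power series with factorial denominators *)

Lemma cvg_pseries_fact (R : realType) (a : nat -> R) (K t : R) :
  (forall k, `|a k| <= K ^+ k) -> cvgn (pseries (fun k => a k / k`!%:R) t).
Proof.
move=> aK; apply: normed_cvg.
have K0 : 0 <= K by rewrite -[K]expr1; exact: le_trans (aK 1%N).
have := is_cvg_series_exp_coeff (K * `|t|).
apply: series_le_cvg => [k|k|k] //=; rewrite /exp_coeff/=.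
- by rewrite divr_ge0// exprn_ge0// mulr_ge0.
- rewrite !normrM normrX normfV [`|_%:R|]ger0_norm// exprMn.
  by rewrite mulrAC ler_wpM2r// ler_wpM2r// exprn_ge0.
Qed.

(** For an exponential generating function, differentiation shifts the sequence [a] by one. *)
Lemma is_derive_pseries_fact (R : realType) (a : nat -> R) (K t : R) :
  (forall k, `|a k| <= K ^+ k) ->
  is_derive t (1 : R) (fun s => limn (pseries (fun k => a k / k`!%:R) s))
    (limn (pseries (fun k => a k.+1 / k`!%:R) t)).
Proof.
move=> aK; have dE (b : nat -> R) :
    pseries_diffs (fun k => b k / k`!%:R) = (fun k => b k.+1 / k`!%:R).
  apply/funext => k; rewrite /pseries_diffs factS natrM invfM; field.
  by rewrite pnatr_eq0 -lt0n fact_gt0 /= addrC natr1 pnatr_eq0.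
have K0 : 0 <= K by rewrite -[K]expr1; exact: le_trans (aK 1%N).
(* Passing from [K] to [K + 1] makes the factor split off positive, so that it can be divided out
   even when [K = 0]. *)
have bnd m k : `|a (k + m)%N| <= (K + 1) ^+ m * (K + 1) ^+ k.
  rewrite -exprD addnC (le_trans (aK _))// lerXn2r ?nnegrE ?addr_ge0//.
  by rewrite lerDl.
have cvgm m s : cvgn (pseries (fun k => a (k + m)%N / k`!%:R) s).
  pose c := (K + 1) ^+ m.
  have c0 : 0 < c by rewrite exprn_gt0// ltr_wpDl.
  have -> : pseries (fun k => a (k + m)%N / k`!%:R) s =
      (fun N => c * pseries (fun k => (a (k + m)%N / c) / k`!%:R) s N).
    apply/funext => N; rewrite /pseries /series/= mulr_sumr; apply: eq_bigr => k _.
    by field; rewrite pnatr_eq0 -lt0n fact_gt0 /= gt_eqF.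
  suff /(cvgMr (a := c)) : cvgn (pseries (fun k => a (k + m)%N / c / k`!%:R) s).
    exact: cvgP.
  apply: (@cvg_pseries_fact _ _ (K + 1)) => k.
  by rewrite normrM normfV [`|c|]gtr0_norm// ler_pdivrMr// mulrC bnd.
(* Termwise differentiation at [t] asks that the series and its first two derived series converge at
   a radius beyond [|t|]. *)
rewrite -(dE a); apply: (@pseries_snd_diffs _ _ (`|t| + 1)).
- by have := cvgm 0%N (`|t| + 1); under eq_fun do rewrite addn0.
- by rewrite dE; have := cvgm 1%N (`|t| + 1); under eq_fun do rewrite addn1.
- rewrite dE (dE (a \o succn)) /=.
  by have := cvgm 2%N (`|t| + 1); under eq_fun do rewrite addn2.
- by rewrite [ltRHS]ger0_norm// ltrDl.
Qed.

(** * Existence by the exponential series *)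

Section existence.
Variables (R : realType) (p q rho : R) (n : nat).
Hypotheses (p0 : 0 <= p) (q0 : 0 <= q).
Variable f0 : {ffun 'I_n -> nat} -> R.
Hypothesis f0_le1 : forall x, `|f0 x| <= 1.

Let K := Dgen_norm p q rho n.

Let a (k : nat) : {ffun 'I_n -> nat} -> R := iter k (Dgen p q rho (n := n)) f0.

Let a_le k x : `|a k x| <= K ^+ k.
Proof.
elim: k x => [|k IH] x; first by rewrite expr0.
by rewrite exprS; apply: Dgen_le => // *; exact: IH.
Qed.

Definition exp_Dgen (t : R) (x : {ffun 'I_n -> nat}) : R :=
  limn (pseries (fun k => a k x / k`!%:R) t).

Lemma exp_Dgen0 x : exp_Dgen 0 x = f0 x.
Proof.
(* The empty partial sum is skipped; every later one equals [f0 x]. *)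
apply/cvg_lim => //; rewrite -(cvg_shiftn 1).
rewrite (_ : (fun N => _) = fun=> f0 x); first exact: cvg_cst.
apply/funext => N; rewrite /pseries /series/= addn1 big_nat_recl// big1.
  by rewrite /a /= expr0 fact0 divr1 mulr1 addr0.
by move=> i _; rewrite expr0n mulr0.
Qed.

(** Termwise differentiation replaces [a k] by [a k.+1], which is [Dgen] applied to [a k]; since
    [Dgen] at [x] reads finitely many values, it can be taken out of the limit. *)
Lemma exp_Dgen_evolution t x :
  derive_nonneg (exp_Dgen ^~ x) t (Dgen p q rho (exp_Dgen t) x).
Proof.
apply: is_derive_derive_nonneg.
have -> : Dgen p q rho (exp_Dgen t) x = limn (pseries (fun k => a k.+1 x / k`!%:R) t).
  apply/esym/cvg_lim => //.
  have /(_ t) cvgu : forall s y, pseries (fun k => a k y / k`!%:R) s @ \oo --> exp_Dgen s y.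
    by move=> s y; exact: (cvg_pseries_fact (K := K)).
  have := is_combination_cvg (Dgen_combination p q rho x) cvgu.
  rewrite (_ : (fun N => _) = pseries (fun k => a k.+1 x / k`!%:R) t)//.
  apply/funext => N.
  rewrite /pseries /series/=; elim: N => [|N IH].
    have [s Ls] := Dgen_combination p q rho x; rewrite Ls big_nil big1// => j _.
    by rewrite big_nil mulr0.
  have -> : (fun y => \sum_(0 <= k < N.+1) a k y / k`!%:R * t ^+ k) =
      (fun y => t ^+ N / N`!%:R * a N y + \sum_(0 <= k < N) a k y / k`!%:R * t ^+ k).
    apply/funext => y; rewrite big_nat_recr//= addrC; congr (_ + _).
    by rewrite mulrAC [RHS]mulrC mulrA.
  rewrite (is_combination_linear _ _ _ (Dgen_combination p q rho x)) IH.
  by rewrite big_nat_recr//= [RHS]addrC; congr (_ + _); rewrite mulrC mulrA mulrAC.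
exact: (is_derive_pseries_fact (K := K)).
Qed.

Lemma exp_Dgen_le t x : 0 <= t -> `|exp_Dgen t x| <= expR (K * t).
Proof.
move=> t0; have K0 : 0 <= K by exact/ltW/Dgen_norm_gt0.
have cu : pseries (fun k => a k x / k`!%:R) t @ \oo --> exp_Dgen t x.
  by exact: (cvg_pseries_fact (K := K)).
apply: (cvgr_to_le (cvg_norm cu)); apply: nearW => N.
apply: (@le_trans _ _ (series (exp_coeff (K * t)) N)); last first.
  apply: nondecreasing_cvgn_le; last exact: is_cvg_series_exp_coeff.
  apply: nondecreasing_series => k _ _; apply: exp_coeff_ge0.
  exact: mulr_ge0.
rewrite /pseries /series/=; apply: le_trans (ler_norm_sum _ _ _) _.
apply: ler_sum => k _; rewrite /exp_coeff/= !normrM normrX normfV.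
rewrite (ger0_norm t0) [`|_%:R|]ger0_norm// exprMn mulrAC.
by rewrite ler_wpM2r// ler_wpM2r// exprn_ge0.
Qed.

Lemma exp_Dgen_solution (eta : config) :
  (forall x, weyl x -> f0 x = Hdual (q / p) eta x) ->
  solution p q rho eta exp_Dgen.
Proof.
move=> f0E; split=> [x t wx t0|T T0|x wx].
- exact: exp_Dgen_evolution.
(* The solution is bounded on [[0, T]], so any positive exponent will do. *)
- exists 1, (expR (K * T)); split; [by []|exact: expR_gt0|].
  move=> t x /andP[t0 tT] wx; apply: le_trans (exp_Dgen_le x t0) _.
  apply: (@le_trans _ _ (expR (K * T))).
    by rewrite ler_expR ler_wpM2l// ltW// Dgen_norm_gt0.
  by rewrite ler_peMr ?expR_ge0//; exact: weight_ge1.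
- by rewrite exp_Dgen0 f0E.
Qed.

End existence.

(** * Duality for truncated functionals *)

Section gaps.
Variable n : nat.
Implicit Types (x : {ffun 'I_n -> nat}) (i j : 'I_n).

Lemma left_gapE x i j : j.+1 = i :> nat -> left_gap x i = ((x j).+1 < x i)%N.
Proof.
move=> ji; apply/forallP/idP => [/(_ j)|gap k]; first by rewrite ji eqxx.
by apply/implyP => /eqP; rewrite -ji => -[/val_inj ->].
Qed.

Lemma right_gapE x i j : j = i.+1 :> nat -> right_gap x i = ((x i).+1 < x j)%N.
Proof.
move=> ji; apply/forallP/idP => [/(_ j)|gap k]; first by rewrite ji eqxx.
by apply/implyP => /eqP; rewrite -ji => /val_inj ->.
Qed.

End gaps.

(* A missing gap between [x_i] and [x_{i+1}] is seen from both sides. *)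
Lemma sum_adjacent (R : realType) (n : nat) (x : {ffun 'I_n -> nat}) (g : nat -> R) :
  weyl x ->
  \sum_(i < n | (0 < i)%N && ~~ left_gap x i) g (x i).-1 =
  \sum_(i < n | ~~ right_gap x i) g (x i).
Proof.
case: n x => [|n] x [_ xlt]; first by rewrite !big_ord0.
(* The first index contributes nothing on the left and the last one nothing on the right; the
   remaining indices are matched with their successors. *)
rewrite [LHS]big_mkcond [RHS]big_mkcond/= big_ord_recl [RHS]big_ord_recr/= add0r.
have -> : right_gap x ord_max.
  apply/forallP => j; apply/implyP => /eqP jn.
  by have := ltn_ord j; rewrite jn ltnn.
rewrite addr0; apply: eq_bigr => i _.
pose j : 'I_n.+1 := widen_ord (leqnSn n) i; pose k := lift ord0 i.
rewrite -/j -/k (@left_gapE _ x k j)// (@right_gapE _ x j k)//.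
(* Strictly increasing coordinates without a gap differ by exactly 1. *)
case: ltnP => //= xjk; congr g.
suff -> : x k = (x j).+1 by [].
by apply/eqP; rewrite eqn_leq xjk xlt.
Qed.

(** * Action of [Dgen] on product functions *)

Section product_functions.
Variables (R : realType) (p q rho : R) (n : nat).
Hypotheses (p_neq0 : p != 0).
Variables (phi : nat -> R) (e : nat -> bool).
Hypothesis phi_rec : forall z, (0 < z)%N ->
  phi z = (if e z then q / p else 1) * phi z.+1.

(** By the recursion, an upward move contributes [e (x i)] and a downward one [- e (x i).-1], up to
    the common factor. The moves blocked by a neighbour would cancel in pairs, so the sum may run
    over all coordinates as if there were no exclusion. *)
Lemma Dgen_product (x : {ffun 'I_n -> nat}) : weyl x ->
  Dgen p q rho (fun y : {ffun 'I_n -> nat} => \prod_(i < n) phi (y i)) x =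
  (p - q) * \prod_(i < n) phi (x i) *
    \sum_(i < n) ((e (x i))%:R - (if (1 < x i)%N then (e (x i).-1)%:R else rho)).
Proof.
move=> wx; have [x1 xlt] := wx; set F := \prod_(i < n) phi (x i).
have upE i : q * ((\prod_(j < n) phi (up x i j)) - F) = (p - q) * F * (e (x i))%:R.
  rewrite /F (bigD1 i)//= [in X in _ * (_ - X)](bigD1 i)//= [in RHS](bigD1 i)//=.
  rewrite (eq_bigr (fun j => phi (x j))); last first.
    by move=> j ji; rewrite ffunE (negbTE ji).
  rewrite ffunE eqxx (phi_rec (x1 i)); case: (e (x i)) => /=; last by ring.
  by field.
have downE i : (1 < x i)%N ->
    p * ((\prod_(j < n) phi (down x i j)) - F) = - ((p - q) * F * (e (x i).-1)%:R).
  move=> xi; rewrite /F (bigD1 i)//= [in X in _ * (_ - X)](bigD1 i)//= [in RHS](bigD1 i)//=.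
  rewrite (eq_bigr (fun j => phi (x j))); last first.
    by move=> j ji; rewrite ffunE (negbTE ji).
  have xi0 : (0 < (x i).-1)%N by rewrite -ltnS (ltn_predK xi).
  rewrite ffunE eqxx (phi_rec xi0) (ltn_predK xi); case: (e _) => /=; last by ring.
  by field.
have xgt1 (i : 'I_n) : (0 < i)%N -> (1 < x i)%N.
  move=> i0; have n0 : (0 < n)%N by apply: leq_ltn_trans _ (ltn_ord i).
  exact: leq_ltn_trans (x1 (Ordinal n0)) (xlt (Ordinal n0) i i0).
rewrite /Dgen /= -/F.
rewrite [X in X + _ + _](eq_bigr (fun i => (p - q) * F * - (e (x i).-1)%:R)); last first.
  by move=> i /andP[/xgt1 xi _]; rewrite downE// mulrN.
rewrite [X in _ + X + _](eq_bigr (fun i => (p - q) * F * (e (x i))%:R)); last first.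
  by move=> i _; exact: upE.
rewrite [X in _ + _ + X](eq_bigr (fun i : 'I_n => (p - q) * F *
    - (if (1 < x i)%N then (e (x i).-1)%:R else rho))); last first.
  move=> i _; have := x1 i; rewrite leq_eqVlt => /predU1P[xi|xi].
    by rewrite -xi /=; ring.
  by rewrite xi downE// gtn_eqF//=; ring.
rewrite -!mulr_sumr -!mulrDr !sumrN; congr (_ * _).
(* The unrestricted sums are split according to gaps; the parts without a gap agree by
   [sum_adjacent]. *)
rewrite sumrB [X in _ = X - _](bigID (right_gap x))/=.
rewrite [X in _ = _ - X](bigID (fun i : 'I_n => i == 0%N :> nat))/=.
rewrite [X in _ = _ - (_ + X)](eq_bigr (fun i : 'I_n => (e (x i).-1)%:R)); last first.
  by move=> i; rewrite -lt0n => /xgt1 ->.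
rewrite [X in _ = _ - (_ + X)](eq_bigl (fun i : 'I_n => 0 < i)%N); last by move=> i; rewrite lt0n.
rewrite [X in _ = _ - (_ + X)](bigID (left_gap x))/=.
by rewrite (sum_adjacent (fun z => (e z)%:R))//; ring.
Qed.

End product_functions.

(** * The ASEP generator on functions of finitely many sites *)

Section occupation.
Variable eta : config.

Lemma occ_swap y z : (0 < y)%N -> (0 < z)%N -> occ (swap eta y) z =
  if z == y then occ eta y.+1 else if z == y.+1 then occ eta y else occ eta z.
Proof. by move=> y0 z0; rewrite /occ/= /swap prednK. Qed.

Lemma occ_flip1 z : (0 < z)%N ->
  occ (flip1 eta) z = if z == 1%N then ~~ occ eta 1 else occ eta z.
Proof. by move=> z0; rewrite /occ/= /flip1 prednK. Qed.

End occupation.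

(** This is [local] with its bound made explicit, which tells where the sum in [asep_L] stops. *)
Definition depends_on_first (R : realType) (M : nat) (f : config -> R) : Prop :=
  forall eta zeta : config,
    (forall x, (1 <= x <= M)%N -> occ eta x = occ zeta x) -> f eta = f zeta.

Definition bond_rate (R : realType) (p q : R) (eta : config) (x : nat) : R :=
  p * (occ eta x && ~~ occ eta x.+1)%:R + q * (occ eta x.+1 && ~~ occ eta x)%:R.

(** A swap of [x] and [x.+1] with [x > M] does not touch the first [M] sites. The bond at [M]
    remains, as it changes site [M]. *)
Lemma asep_L_finite (R : realType) (p q alpha gamma : R) (M : nat)
    (f : config -> R) (eta : config) : depends_on_first M f ->
  asep_L p q alpha gamma f eta =
    \sum_(1 <= x < M.+1) bond_rate p q eta x * (f (swap eta x) - f eta)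
    + (alpha * (~~ occ eta 1)%:R + gamma * (occ eta 1)%:R) * (f (flip1 eta) - f eta).
Proof.
move=> fM; rewrite /asep_L; congr (_ + _); apply/cvg_lim => //.
rewrite -(cvg_shiftn M.+1).
rewrite (_ : (fun N => _) = fun=>
  \sum_(1 <= x < M.+1) bond_rate p q eta x * (f (swap eta x) - f eta)).
  exact: cvg_cst.
apply/funext => N; rewrite (big_cat_nat _ _ (n := M.+1))//= ?leq_addl//.
rewrite [X in _ + X]big_nat_cond [X in _ + X]big1 ?addr0// => x /andP[/andP[Mx _] _].
rewrite (fM _ eta) ?subrr ?mulr0// => z /andP[z0 zM].
rewrite occ_swap//; last exact: leq_ltn_trans Mx.
have zx : (z < x)%N := leq_ltn_trans zM Mx.
by rewrite (ltn_eqF zx) ltn_eqF// ltnS ltnW.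
Qed.

(** * Duality up to an error at the truncation level *)

Section truncated_duality.
Variables (R : realType) (p q alpha gamma : R) (n L : nat).
Hypotheses (q_gt0 : 0 < q) (q_lt_p : q < p)
  (liggett : alpha / p + gamma / q = 1).

Let p_gt0 : 0 < p. Proof. exact: lt_trans q_lt_p. Qed.
Let r_gt0 : 0 < q / p. Proof. exact: divr_gt0. Qed.
Let r_le1 : q / p <= 1. Proof. by rewrite ler_pdivrMr// mul1r ltW. Qed.

Definition site_weight (r : R) (eta : config) (z : nat) : R :=
  if occ eta z then r else 1.

(* The truncations of [Qpow] and [Hdual] to the sites [<= L]. *)
Definition Qtrunc (r : R) (eta : config) (z : nat) : R :=
  \prod_(z <= k < L.+1) site_weight r eta k.

Definition Htrunc (r : R) (eta : config) (x : {ffun 'I_n -> nat}) : R :=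
  \prod_(i < n) Qtrunc r eta (x i).

Local Notation r := (q / p).

Lemma Qtrunc_rec (s : R) eta z : (z <= L)%N ->
  Qtrunc s eta z = site_weight s eta z * Qtrunc s eta z.+1.
Proof. by move=> zL; rewrite /Qtrunc big_ltn// ltnS. Qed.

Lemma Qtrunc_gt (s : R) eta z : (L < z)%N -> Qtrunc s eta z = 1.
Proof. by move=> zL; rewrite /Qtrunc big_geq. Qed.

Lemma site_weight_itv eta z : 0 <= site_weight r eta z <= 1.
Proof. by rewrite /site_weight; case: ifP => _; rewrite ?lexx ?ler01// ltW. Qed.

Lemma Qtrunc_itv eta z : 0 <= Qtrunc r eta z <= 1.
Proof.
rewrite /Qtrunc; elim/big_ind: _ => [|a b /andP[a0 a1] /andP[b0 b1]|k _].
- by rewrite ler01 lexx.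
- by rewrite mulr_ge0//= mulr_ile1.
- exact: site_weight_itv.
Qed.

Lemma Htrunc_itv eta x : 0 <= Htrunc r eta x <= 1.
Proof.
rewrite /Htrunc; elim/big_ind: _ => [|a b /andP[a0 a1] /andP[b0 b1]|k _].
- by rewrite ler01 lexx.
- by rewrite mulr_ge0//= mulr_ile1.
- exact: Qtrunc_itv.
Qed.

Lemma Qtrunc_local (s : R) eta zeta z : (0 < z)%N ->
  (forall k, (1 <= k <= L)%N -> occ eta k = occ zeta k) ->
  Qtrunc s eta z = Qtrunc s zeta z.
Proof.
move=> z0 ez; apply: eq_big_nat => k /andP[zk kL].
by rewrite /site_weight ez// (leq_trans z0 zk).
Qed.

Lemma Htrunc_depends (s : R) x : weyl x ->
  depends_on_first L (fun eta => Htrunc s eta x).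
Proof.
move=> [x1 _] eta zeta ez; apply: eq_bigr => i _; exact: Qtrunc_local.
Qed.

(** Unless [z] separates the sites [y] and [y.+1], the product contains both of their factors or
    neither. *)
Lemma Qtrunc_swap_neq eta y z : (0 < y < L)%N -> (0 < z)%N -> z != y.+1 ->
  Qtrunc r (swap eta y) z = Qtrunc r eta z.
Proof.
move=> /andP[y0 yL] z0 zy.
have far k : (0 < k)%N -> k != y -> k != y.+1 ->
    site_weight r (swap eta y) k = site_weight r eta k.
  by move=> k0 ky ky1; rewrite /site_weight occ_swap// (negbTE ky) (negbTE ky1).
have yy1 : site_weight r (swap eta y) y * site_weight r (swap eta y) y.+1 =
    site_weight r eta y * site_weight r eta y.+1.
  by rewrite /site_weight !occ_swap// !eqxx gtn_eqF// mulrC.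
have above k : (y.+1 < k)%N -> Qtrunc r (swap eta y) k = Qtrunc r eta k.
  move=> yk; apply: eq_big_nat => m /andP[km _].
  have ym : (y.+1 < m)%N by exact: leq_trans yk km.
  by rewrite far ?(leq_trans _ ym)// gtn_eqF// ltnW.
case: (ltnP y.+1 z) => [|zy1]; first exact: above.
have {zy zy1}zy : (z <= y)%N by rewrite -ltnS ltn_neqAle zy.
have split xi : Qtrunc r xi z = (\prod_(z <= k < y) site_weight r xi k) *
    (site_weight r xi y * site_weight r xi y.+1 * Qtrunc r xi y.+2).
  have yL1 : (y <= L.+1)%N by rewrite ltnW// ltnS ltnW.
  rewrite {1}/Qtrunc (big_cat_nat _ _ (n := y))//=; congr (_ * _).
  by rewrite -/(Qtrunc r xi y) Qtrunc_rec ?(ltnW yL)// Qtrunc_rec// mulrA.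
rewrite !split yy1 above//; congr (_ * _); apply: eq_big_nat => k /andP[zk ky].
by rewrite far// ?(leq_trans z0)// ltn_eqF// ltnS ltnW.
Qed.

Lemma Qtrunc_swap_eq eta y : (0 < y < L)%N ->
  Qtrunc r (swap eta y) y.+1 = site_weight r eta y * Qtrunc r eta y.+2.
Proof.
move=> /andP[y0 yL]; rewrite Qtrunc_rec//.
rewrite {1}/site_weight occ_swap// eqxx gtn_eqF// -/(site_weight r eta y).
congr (_ * _); apply: eq_big_nat => m /andP[km _].
by rewrite /site_weight occ_swap ?(leq_trans _ km)// !gtn_eqF// (leq_trans _ km).
Qed.

(** At most one coordinate equals [y.+1], and only its factor changes. The result is kept as a sum
    over coordinates so that it can be exchanged with the sum over bonds. *)
Lemma bond_term eta x y : weyl x -> (0 < y < L)%N ->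
  bond_rate p q eta y * (Htrunc r (swap eta y) x - Htrunc r eta x) =
  \sum_(i < n | x i == y.+1)
     (p - q) * Htrunc r eta x * ((occ eta (x i))%:R - (occ eta (x i).-1)%:R).
Proof.
move=> [x1 xlt] /andP[y0 yL].
have [/existsP[i /eqP xi]|] := boolP [exists i, x i == y.+1]; last first.
  rewrite negb_exists => /forallP xy; rewrite big_pred0; last first.
    by move=> i; rewrite (negbTE (xy i)).
  rewrite [X in X - _](_ : _ = Htrunc r eta x) ?subrr ?mulr0//.
  by apply: eq_bigr => i _; rewrite Qtrunc_swap_neq// y0.
have inj j : x j == y.+1 -> j = i.
  move=> /eqP xj; case: (ltngtP j i) => [/xlt|/xlt|/val_inj//];
  by rewrite xi xj ltnn.
rewrite (big_pred1 i); last first.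
  by move=> j; apply/idP/eqP => [|->]; [exact: inj|rewrite xi].
rewrite {1 2}/Htrunc (bigD1 i)//= [in X in _ * (_ - X)](bigD1 i)//=.
rewrite [in RHS]/Htrunc [in RHS](bigD1 i)//=.
rewrite (eq_bigr (fun j => Qtrunc r eta (x j))); last first.
  move=> j ji; rewrite Qtrunc_swap_neq// ?y0//.
  by apply: contra_neq ji => xj; apply: inj; rewrite xj.
rewrite xi Qtrunc_swap_eq ?y0// (Qtrunc_rec r eta yL) /= /bond_rate /site_weight.
have pn0 : p != 0 by rewrite gt_eqF.
by case: (occ eta y); case: (occ eta y.+1) => /=; field.
Qed.

(** The bond from [L] to [L.+1] straddles the truncation, so duality fails there and a crude bound
    by the jump rates is used. *)
Lemma last_bond_term eta x :
  `|bond_rate p q eta L * (Htrunc r (swap eta L) x - Htrunc r eta x)| <=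
  p * (occ eta L)%:R + q * (occ eta L.+1)%:R.
Proof.
rewrite normrM; have diff : `|Htrunc r (swap eta L) x - Htrunc r eta x| <= 1.
  have /andP[? ?] := Htrunc_itv eta x.
  have /andP[? ?] := Htrunc_itv (swap eta L) x.
  by rewrite ler_norml; apply/andP; split; lra.
apply: le_trans (ler_wpM2l (normr_ge0 _) diff) _; rewrite mulr1 /bond_rate.
rewrite ger0_norm ?addr_ge0 ?mulr_ge0 ?(ltW p_gt0) ?(ltW q_gt0)//.
by apply: lerD; (rewrite ler_wpM2l ?(ltW p_gt0) ?(ltW q_gt0)//);
  case: (occ eta L); case: (occ eta L.+1).
Qed.

(** Only a coordinate at site 1 feels the reservoir. Creation produces the term in [alpha / p], and
    the condition on the rates makes annihilation produce the same one. *)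
Lemma boundary_term eta x : weyl x -> (0 < L)%N ->
  (alpha * (~~ occ eta 1)%:R + gamma * (occ eta 1)%:R) *
    (Htrunc r (flip1 eta) x - Htrunc r eta x) =
  \sum_(i < n | x i == 1%N)
     (p - q) * Htrunc r eta x * ((occ eta (x i))%:R - alpha / p).
Proof.
move=> [x1 xlt] L0.
have above k : (1 < k)%N -> Qtrunc r (flip1 eta) k = Qtrunc r eta k.
  move=> k1; apply: eq_big_nat => m /andP[km _].
  have m1 : (1 < m)%N := leq_trans k1 km.
  by rewrite /site_weight occ_flip1 ?gtn_eqF// ltnW.
have [/existsP[i /eqP xi]|] := boolP [exists i, x i == 1%N]; last first.
  rewrite negb_exists => /forallP xy; rewrite big_pred0; last first.
    by move=> i; rewrite (negbTE (xy i)).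
  rewrite [X in X - _](_ : _ = Htrunc r eta x) ?subrr ?mulr0//.
  by apply: eq_bigr => i _; rewrite above// ltn_neqAle eq_sym xy x1.
have inj j : x j == 1%N -> j = i.
  move=> /eqP xj; case: (ltngtP j i) => [/xlt|/xlt|/val_inj//];
  by rewrite xi xj ltnn.
rewrite (big_pred1 i); last first.
  by move=> j; apply/idP/eqP => [|->]; [exact: inj|rewrite xi].
rewrite {1 2}/Htrunc (bigD1 i)//= [in X in _ * (_ - X)](bigD1 i)//=.
rewrite [in RHS]/Htrunc [in RHS](bigD1 i)//=.
rewrite (eq_bigr (fun j => Qtrunc r eta (x j))); last first.
  move=> j ji; rewrite above// ltn_neqAle eq_sym x1 andbT.
  by apply: contra_neq ji => xj; apply: inj; rewrite xj.
rewrite xi !(Qtrunc_rec r _ L0) above// /site_weight occ_flip1//=.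
have pn0 : p != 0 by rewrite gt_eqF.
have qn0 : q != 0 by rewrite gt_eqF.
(* The condition on the rates, solved for [gamma]; it is used when site 1 is occupied. *)
have -> : gamma = q * (1 - alpha / p).
  by rewrite -liggett addrC addKr mulrCA divff// mulr1.
by case: (occ eta 1) => /=; field.
Qed.

(** Coordinates up to [L] match exactly. The error comes from a coordinate at [L.+1], whose downward
    move sees site [L], and from the bond straddling the truncation. *)
Lemma truncated_duality eta x : weyl x -> (0 < L)%N ->
  `|asep_L p q alpha gamma (fun xi => Htrunc r xi x) eta -
    Dgen p q (alpha / p) (Htrunc r eta) x| <=
  (p + n%:R * (p - q)) * (occ eta L)%:R + q * (occ eta L.+1)%:R.
Proof.
move=> wx L0; have [x1 xlt] := wx.
rewrite (asep_L_finite _ _ _ _ _ (Htrunc_depends r wx)) boundary_term//.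
rewrite big_nat_recr//= (eq_big_nat _ _ (F2 := fun y => \sum_(i < n | x i == y.+1)
     (p - q) * Htrunc r eta x * ((occ eta (x i))%:R - (occ eta (x i).-1)%:R))); last first.
  by move=> y yL; exact: bond_term.
set last := bond_rate _ _ _ _ * _.
(* Sites beyond [L] count as empty, so that the recursion holds at every positive site. *)
pose e z := occ eta z && (z <= L)%N.
have eP z : (0 < z)%N -> Qtrunc r eta z = (if e z then r else 1) * Qtrunc r eta z.+1.
  move=> z0; rewrite /e; case: (leqP z L) => zL; first by rewrite andbT Qtrunc_rec.
  by rewrite andbF mul1r !Qtrunc_gt// ltnW.
rewrite /Htrunc (Dgen_product (alpha / p) _ eP wx); last by rewrite gt_eqF.
rewrite -/(Htrunc r eta x); set c := (p - q) * _.
(* After the exchange, a coordinate with [1 < x i <= L] selects the single bond at [(x i).-1]. *)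
rewrite (exchange_big_dep xpredT)//=.
rewrite [X in X + last + _](eq_bigr (fun i => if (1 < x i <= L)%N then
    c * ((occ eta (x i))%:R - (occ eta (x i).-1)%:R) else 0)); last first.
  move=> i _; rewrite (eq_bigl (fun y => y == (x i).-1)); last first.
    by move=> y; rewrite -[in LHS](prednK (x1 i)) eqSS eq_sym.
  rewrite big_nat1_eq; congr (if _ then _ else _).
  by have := x1 i; case: (x i) => [//|[//|m]] _ /=.
rewrite [X in _ + last + X]big_mkcond/= [_ + last + _]addrAC [_ + last - _]addrAC.
rewrite mulr_sumr -big_split/= -sumrB.
(* Coordinate by coordinate, the two sides differ only at [x i = L.+1]. *)
rewrite (eq_bigr (fun i => if x i == L.+1 then c * (occ eta L)%:R else 0)); last first.
  move=> i _; rewrite /e; have := x1 i; rewrite leq_eqVlt => /predU1P[xi|xi].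
    by rewrite -xi /= L0 andbT ltn_eqF// add0r mulrBr subrr.
  rewrite xi (gtn_eqF xi) /= addr0; case: (ltngtP (x i) L.+1) => [|xL|->].
  - rewrite ltnS => xL; rewrite xL (leq_trans (leq_pred _) xL) !andbT.
    by rewrite subrr.
  - rewrite leqNgt (ltnW xL)/= andbF leqNgt.
    by rewrite -ltnS (ltn_predK xi) xL andbF !subr0 mulr0 subr0.
  - by rewrite ltnn leqnn andbF andbT /= !sub0r mulrN opprK.
have -> : (p + n%:R * (p - q)) * (occ eta L)%:R + q * (occ eta L.+1)%:R =
    n%:R * ((p - q) * (occ eta L)%:R) + (p * (occ eta L)%:R + q * (occ eta L.+1)%:R).
  by ring.
apply: le_trans (ler_normD _ _) _; apply: lerD; last exact: last_bond_term.
have pq0 : 0 <= p - q by rewrite subr_ge0 ltW.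
apply: norm_sum_le; first by rewrite mulr_ge0.
move=> i _; case: ifP => _; last by rewrite normr0 mulr_ge0.
have /andP[H0 H1] := Htrunc_itv eta x.
rewrite ger0_norm ?mulr_ge0// /c ler_wpM2r//.
by rewrite ler_piMr.
Qed.

End truncated_duality.

(** * The ASEP semigroup *)

Lemma near_coordinates (eta : cantor_space) (M : nat) :
  \forall zeta \near eta, forall i, (i < M)%N -> zeta i = eta i.
Proof.
elim: M => [|M IH]; first by apply: filterE.
have cM : \forall zeta \near eta, zeta M = eta M.
  exact: (@proj_continuous nat (fun=> bool) M eta [set eta M] (discrete_set1 _)).
apply: filterS2 IH cM => zeta IHz cMz i; rewrite ltnS leq_eqVlt => /predU1P[->//|iM].
exact: IHz.
Qed.

Lemma depends_on_first_continuous (R : realType) (M : nat) (f : config -> R) :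
  depends_on_first M f -> continuous f.
Proof.
move=> fM eta; apply/cvgrPdist_le => e e0.
near=> zeta; suff -> : f eta = f zeta by rewrite subrr normr0 ltW.
apply: fM => x /andP[x0 xM]; apply/esym; rewrite /occ.
have ez : forall i, (i < M)%N -> zeta i = eta i.
  by near: zeta; exact: near_coordinates.
by apply: ez; rewrite prednK.
Unshelve. all: by end_near. Qed.

(** The rate of the bond at [M] reads site [M.+1]. *)
Lemma asep_L_depends (R : realType) (p q alpha gamma : R) (M : nat) (f : config -> R) :
  depends_on_first M f -> depends_on_first M.+1 (asep_L p q alpha gamma f).
Proof.
move=> fM eta zeta ez; rewrite !(asep_L_finite _ _ _ _ _ fM).
have fE : f eta = f zeta.
  by apply: fM => x /andP[x0 xM]; apply: ez; rewrite x0 ltnW.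
rewrite fE ez//; congr (_ + _ * (_ - _)).
  apply: eq_big_nat => x /andP[x0 xM]; rewrite /bond_rate !ez ?x0 ?(ltnW xM)//.
  congr (_ * (_ - _)); apply: fM => y /andP[y0 yM].
  by rewrite !occ_swap// !ez// ?x0 ?y0 ?ltnS ?(leqW yM) ?(ltnW xM).
by apply: fM => y /andP[y0 yM]; rewrite !occ_flip1// !ez// y0 (leqW yM).
Qed.

(** * Consequences of the Markov semigroup axioms *)

Section semigroup.
Variables (R : realType) (S : R -> (config -> R) -> config -> R).
Hypothesis markovS : markov_semigroup S.
Implicit Types (f g k : config -> R) (t : R) (eta : config).

Lemma continuous_comb (a : R) f g : continuous f -> continuous g ->
  continuous (fun xi => a * f xi + g xi).
Proof.
move=> cf cg xi; apply: cvgD; last exact: cg.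
by apply: cvgMr; exact: cf.
Qed.

Lemma semigroupE t (a : R) f g eta : 0 <= t -> continuous f -> continuous g ->
  S t (fun xi => a * f xi + g xi) eta = a * S t f eta + S t g eta.
Proof. by move=> t0 cf cg; rewrite (semigroup_linear markovS). Qed.

Lemma semigroup_le t f g eta : 0 <= t -> continuous f -> continuous g ->
  (forall xi, f xi <= g xi) -> S t f eta <= S t g eta.
Proof.
move=> t0 cf cg fg; have := @semigroup_ge0 _ _ markovS t (fun xi => -1 * f xi + g xi) t0.
move=> /(_ (continuous_comb cf cg)) h.
have := h _ eta; rewrite semigroupE// mulN1r addrC subr_ge0; apply=> xi.
by rewrite mulN1r addrC subr_ge0.
Qed.

Lemma continuous_cst_config (c : R) : continuous (fun _ : config => c).
Proof. by move=> xi; exact: cvg_cst. Qed.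

Lemma semigroup_cst t (c : R) eta : 0 <= t -> S t (fun=> c) eta = c.
Proof.
(* Linearity comes in the form [a * f + g], so a constant is built from two copies of 1. *)
move=> t0; have -> : (fun _ : config => c) = (fun xi => (c - 1) * (fun=> 1) xi + (fun=> 1) xi).
  by apply/funext => xi; rewrite mulr1 subrK.
rewrite semigroupE//; try exact: continuous_cst_config.
by rewrite (semigroup1 markovS)// mulr1 subrK.
Qed.

Lemma semigroup_norm_le t f (c : R) eta : 0 <= t -> continuous f ->
  (forall xi, `|f xi| <= c) -> `|S t f eta| <= c.
Proof.
move=> t0 cf fc; have fc' xi : - c <= f xi <= c by rewrite -ler_norml.
rewrite ler_norml; apply/andP; split.
  rewrite -[X in X <= _](semigroup_cst (- c) eta t0); apply: semigroup_le => //.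
    exact: continuous_cst_config.
  by move=> xi; case/andP: (fc' xi).
rewrite -[X in _ <= X](semigroup_cst c eta t0); apply: semigroup_le => //.
  exact: continuous_cst_config.
by move=> xi; case/andP: (fc' xi).
Qed.

Lemma semigroup_dominated t f g eta : 0 <= t -> continuous f -> continuous g ->
  (forall xi, `|f xi| <= g xi) -> `|S t f eta| <= S t g eta.
Proof.
move=> t0 cf cg fg; rewrite ler_norml; apply/andP; split; last first.
  by apply: semigroup_le => // xi; exact: le_trans (ler_norm _) (fg xi).
rewrite lerNl -mulN1r.
have -> : -1 * S t f eta = S t (fun xi => -1 * f xi + 0) eta.
  by rewrite semigroupE ?semigroup_cst ?addr0//; exact: continuous_cst_config.
apply: semigroup_le => //; first by apply: continuous_comb => //; exact: continuous_cst_config.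
by move=> xi; rewrite mulN1r addr0 (le_trans _ (fg xi))// -normrN ler_norm.
Qed.

(** Continuity is proved along with the identity, because linearity of [S t] is available on
    continuous functions only. *)
Lemma semigroup_combination (I : Type) (L : (I -> R) -> R) t (F : config -> I -> R) eta :
  is_combination L -> 0 <= t -> (forall i, continuous (F ^~ i)) ->
  continuous (fun xi => L (F xi)) /\
  S t (fun xi => L (F xi)) eta = L (fun i => S t (F ^~ i) eta).
Proof.
move=> [s Ls] t0 cF; rewrite Ls.
have -> : (fun xi => L (F xi)) = (fun xi => \sum_(j <- s) j.1 * F xi j.2).
  by apply/funext => xi; exact: Ls.
elim: s {Ls} => [|j s [cs Ss]].
  have -> : (fun xi => \sum_(j <- [::]) j.1 * F xi j.2) = fun=> 0.
    by apply/funext => xi; rewrite big_nil.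
  by rewrite big_nil semigroup_cst//; split=> //; exact: continuous_cst_config.
have -> : (fun xi => \sum_(i <- j :: s) i.1 * F xi i.2) =
    (fun xi => j.1 * F xi j.2 + \sum_(i <- s) i.1 * F xi i.2).
  by apply/funext => xi; rewrite big_cons.
rewrite big_cons -Ss; split; first exact: continuous_comb.
by rewrite semigroupE.
Qed.

(** Forward increments are [S t] applied to the difference quotient at time 0, and [S t] is a
    contraction in the uniform norm. *)
Lemma semigroup_derive t f g eta : 0 <= t -> generator S f g -> continuous g ->
  derive_nonneg (fun s => S s f eta) t (S t g eta).
Proof.
move=> t0 [cf gen] cg; apply/derive_nonnegP => e e0.
have e20 : 0 < e / 2 by rewrite divr_gt0.
have [d1 d10 gen1] : exists2 d, 0 < d & forall h, 0 < h < d ->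
    forall xi, `|h^-1 * (S h f xi - f xi) - g xi| <= e / 2.
  have /nbhs_ballP[d /= d0 dP] := gen _ e20; exists d => // h /andP[h0 hd].
  by apply: dP => //; rewrite /ball/= sub0r normrN gtr0_norm.
have [d2 d20 str2] : exists2 d, 0 < d & forall h, 0 < h < d ->
    forall xi, `|S h g xi - g xi| <= e / 2.
  have /nbhs_ballP[d /= d0 dP] := semigroup_strong markovS cg e20; exists d => // h /andP[h0 hd].
  by apply: dP => //; rewrite /ball/= sub0r normrN gtr0_norm.
have comb s a k l m : 0 <= s -> continuous k -> continuous l -> continuous m ->
    continuous (fun xi => a * (k xi - l xi) - m xi) /\
    S s (fun xi => a * (k xi - l xi) - m xi) eta = a * (S s k eta - S s l eta) - S s m eta.
  move=> s0 ck cl cm.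
  have -> : (fun xi => a * (k xi - l xi) - m xi) =
      (fun xi => a * k xi + (- a * l xi + (-1 * m xi + 0))).
    by apply/funext => xi; ring.
  have c0 := @continuous_cst_config 0.
  have c1 := continuous_comb (a := -1) cm c0.
  have c2 := continuous_comb (a := - a) cl c1.
  split; first exact: continuous_comb.
  by rewrite !semigroupE// semigroup_cst//; ring.
have cS s k : 0 <= s -> continuous k -> continuous (S s k).
  exact: semigroup_continuous.
exists (Num.min d1 d2); first by rewrite lt_min d10.
move=> h; rewrite lt_min => /andP[hd1 hd2]; rewrite neq_lt => /orP[hneg|hpos] th.
(* For a backward increment, [S (t + h)] is factored out; [S (- h) g] then replaces [g], which
   strong continuity controls. *)
- have h'0 : 0 < - h by rewrite oppr_gt0.
  have h'd1 : - h < d1 by rewrite -ltr0_norm.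
  have h'd2 : - h < d2 by rewrite -ltr0_norm.
  have SE k : continuous k -> S t k = S (t + h) (S (- h) k).
    by move=> ck; rewrite -(semigroupD markovS) ?addrK//; exact: ltW.
  have [ck kE] := comb (t + h) (- h)^-1 _ _ _ th
    (cS (- h) f (ltW h'0) cf) cf (cS (- h) g (ltW h'0) cg).
  rewrite (SE f cf) (SE g cg).
  have flip (a b : R) : h^-1 * (a - b) = (- h)^-1 * (b - a) by rewrite invrN; ring.
  rewrite flip -kE.
  apply: semigroup_norm_le => // xi.
  have -> : (- h)^-1 * (S (- h) f xi - f xi) - S (- h) g xi =
    ((- h)^-1 * (S (- h) f xi - f xi) - g xi) - (S (- h) g xi - g xi) by ring.
  apply: le_trans (ler_normB _ _) _; rewrite [leRHS](splitr e) lerD//.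
    by apply: gen1; rewrite h'0.
  by apply: str2; rewrite h'0.
- have hd1' : h < d1 by rewrite -[h]gtr0_norm.
  have [ck kE] := comb t h^-1 _ _ _ t0 (cS h f (ltW hpos) cf) cf cg.
  rewrite (semigroupD markovS) ?(ltW hpos)// -kE.
  apply: semigroup_norm_le => // xi; apply: le_trans (gen1 _ _ _) _; first by rewrite hpos.
  by rewrite ler_pdivrMr// ler_peMr ?ltW// ltr1n.
Qed.

End semigroup.

(** * Finite speed of propagation *)

Section asep_occupation.
Variables (R : realType) (p q alpha gamma : R).
Variable (S : R -> (config -> R) -> config -> R).
Hypotheses (p0 : 0 <= p) (q0 : 0 <= q).
Hypothesis asepS : asep_semigroup p q alpha gamma S.

(** A function of finitely many sites lies in the domain of the closure, being its own
    approximation. *)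
Lemma asep_derive (M : nat) (t : R) (f : config -> R) (eta : config) :
  0 <= t -> depends_on_first M f ->
  derive_nonneg (fun s => S s f eta) t (S t (asep_L p q alpha gamma f) eta).
Proof.
move=> t0 fM; have [markovS gen] := asepS; apply: semigroup_derive => //; last first.
  exact: depends_on_first_continuous (asep_L_depends _ _ _ _ fM).
apply/gen => e e0; exists f; split; first by exists M.
by move=> xi; rewrite !subrr normr0 ltW.
Qed.

Lemma occ_depends (x : nat) : (0 < x)%N ->
  depends_on_first x (fun xi => (occ xi x)%:R : R).
Proof. by move=> x0 eta zeta ez; rewrite ez// x0 leqnn. Qed.

(** Losses and exclusion are dropped, which leaves the gain from the two neighbours. The reservoir
    acts on site 1 only. *)
Lemma asep_L_occ (x : nat) (xi : config) : (1 < x)%N ->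
  asep_L p q alpha gamma (fun zeta => (occ zeta x)%:R) xi <=
  p * (occ xi x.-1)%:R + q * (occ xi x.+1)%:R.
Proof.
case: x => [//|[//|z]] _; rewrite (asep_L_finite _ _ _ _ _ (@occ_depends z.+2 isT))//.
rewrite occ_flip1//= subrr mulr0 addr0 big_nat_recr//= big_nat_recr//=.
rewrite big_nat_cond big1 ?add0r; last first.
  move=> y /andP[/andP[y0 yz] _].
  by rewrite occ_swap// eqSS (gtn_eqF yz) gtn_eqF ?subrr ?mulr0// ltnW.
rewrite !occ_swap// !eqxx gtn_eqF// /bond_rate.
by case: (occ xi z.+1); case: (occ xi z.+2); case: (occ xi z.+3) => /=; move: p0 q0; lra.
Qed.

(* Particles move at finite speed, up to factorially small probabilities. *)
Lemma asep_occ_le (eta : config) (x0 : nat) : (0 < x0)%N ->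
  (forall x, (x0 < x)%N -> ~~ occ eta x) ->
  forall k x t, (x0 + k < x)%N -> 0 <= t ->
    S t (fun xi => (occ xi x)%:R) eta <= ((p + q) * t) ^+ k / k`!%:R.
Proof.
move=> x00 eta0; have [markovS _] := asepS.
have cocc x : (0 < x)%N -> continuous (fun xi : config => (occ xi x)%:R : R).
  by move=> /occ_depends; exact: depends_on_first_continuous.
elim=> [|k IH] x t xk t0.
  rewrite expr0 fact0 divr1 -[leRHS](semigroup_cst markovS 1 eta t0).
  apply: semigroup_le => //; [|exact: continuous_cst_config|by move=> xi; case: (occ xi x)].
  by apply: cocc; exact: leq_ltn_trans xk.
(* The sites considered stay away from the reservoir. *)
have x1 : (1 < x)%N.
  by apply: leq_ltn_trans xk; rewrite addnS ltnW// ltnS (leq_trans x00)// leq_addr.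
have x0' : (0 < x)%N by exact: ltnW.
have xp : (0 < x.-1)%N by rewrite -ltnS prednK.
(* Both neighbours of [x] satisfy the bound of order [k]; integrating it from the initial value 0
   gives order [k.+1]. *)
apply: (@derive_nonneg_le _ (fun s => S s (fun xi => (occ xi x)%:R) eta)
  (fun s => S s (asep_L p q alpha gamma (fun xi => (occ xi x)%:R)) eta)
  (fun s => ((p + q) * s) ^+ k.+1 / k.+1`!%:R)
  (fun s => (p + q) * (((p + q) * s) ^+ k / k`!%:R)) t) => [s|s _|s||].
- by move=> /andP[s0 _]; apply: asep_derive s0 (occ_depends x0').
- exact: derive_nonneg_expr_fact.
- move=> /andP[s0 _].
  apply: (@le_trans _ _ (S s (fun xi => p * (occ xi x.-1)%:R + (q * (occ xi x.+1)%:R + 0)) eta)).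
    apply: semigroup_le => //.
    + exact: depends_on_first_continuous (asep_L_depends _ _ _ _ (occ_depends x0')).
    + by do 2 (apply: continuous_comb; first exact: cocc); exact: continuous_cst_config.
    + by move=> xi; rewrite addr0; exact: asep_L_occ.
  rewrite !semigroupE ?semigroup_cst ?addr0//;
    try exact: cocc; try exact: continuous_cst_config; last first.
    by apply: continuous_comb; [exact: cocc|exact: continuous_cst_config].
  rewrite mulrDl lerD// ler_wpM2l// IH//.
    by rewrite -ltnS prednK// (leq_trans _ xk)// addnS.
  by rewrite (leq_trans _ (leqW (ltnW xk)))// addnS.
- rewrite (semigroup0 markovS); last exact: cocc.
  have -> : occ eta x = false.
    by apply/negbTE/eta0; apply: leq_ltn_trans xk; rewrite leq_addr.
  by rewrite mulr0 expr0n mul0r.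
- by rewrite t0 lexx.
Qed.

End asep_occupation.

(** * Removal of the truncation *)

Section truncation_limit.
Variables (R : realType) (r : R).
Hypotheses (r_gt0 : 0 < r) (r_lt1 : r < 1).

Let count (eta : config) (z L : nat) : nat := (\sum_(z <= k < L.+1) occ eta k)%N.

Let QtruncE L eta z : Qtrunc L r eta z = r ^+ count eta z L.
Proof.
rewrite /Qtrunc /count; elim/big_ind2: _ => // [a b c d -> ->|k _].
  by rewrite exprD.
by rewrite /site_weight; case: (occ eta k).
Qed.

Let count_cvg eta z : ((count eta z L)%:R : R)%:E @[L --> \oo] --> Ncount R z eta.
Proof.
have : (\sum_(z <= k < L) ((occ eta k)%:R : R)%:E)%E @[L --> \oo] --> Ncount R z eta.
  by apply: is_cvg_nneseries => k _ _; rewrite lee_fin.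
rewrite -(cvg_shiftS (fun L => (\sum_(z <= k < L) ((occ eta k)%:R : R)%:E)%E)).
rewrite (_ : (fun L => _) = (fun L => ((count eta z L)%:R : R)%:E))//.
by apply/funext => L; rewrite /count sumEFin natr_sum.
Qed.

(** The number of particles up to [L] converges to [Ncount]. If the limit is infinite, the powers of
    [r] tend to 0, the value that [Qpow] takes there. *)
Lemma Qtrunc_cvg eta z : Qtrunc L r eta z @[L --> \oo] --> Qpow r z eta.
Proof.
have := @count_cvg eta z; rewrite /Qpow.
under [X in _ -> X @ _ --> _]eq_fun do rewrite QtruncE.
case: (Ncount R z eta) => [s|/cvgeyPge ninf|].
- move=> /fine_cvg /= cs.
  rewrite /powR gt_eqF//.
  rewrite (_ : (fun L => _) = (fun L => expR ((count eta z L)%:R * ln r))).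
    by apply: continuous_cvg; [exact: continuous_expR|exact: cvgMl].
  by apply/funext => L; rewrite expRM_natl lnK ?posrE.
- apply/cvgrPdist_le => e e0.
  have r1 : `|r| < 1 by rewrite gtr0_norm.
  have /cvgrPdist_le/(_ e e0)[m _ mP] := cvg_expr r1.
  apply: filterS (ninf m%:R) => L; rewrite lee_fin ler_nat => mL.
  exact: mP mL.
(* Counts are nonnegative and cannot tend to minus infinity. *)
- move=> /cvgeNyPle/(_ (-1)) [m _ /(_ m (leqnn _))] /=.
  by rewrite lee_fin => /(le_trans (ler0n _ _)); rewrite ler0N1.
Qed.

Lemma Htrunc_cvg (n : nat) eta (x : {ffun 'I_n -> nat}) :
  Htrunc L r eta x @[L --> \oo] --> Hdual r eta x.
Proof.
rewrite /Hdual /Htrunc; elim: (index_enum _) => [|i s IH].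
  by under eq_fun do rewrite big_nil; rewrite big_nil; exact: cvg_cst.
under eq_fun do rewrite big_cons.
by rewrite big_cons; apply: cvgM => //; exact: Qtrunc_cvg.
Qed.

(** Empty sites contribute a factor 1, so the truncations are constant from [x0] on and equal their
    limit. *)
Lemma Htrunc_eventually (n x0 L : nat) eta (x : {ffun 'I_n -> nat}) : weyl x ->
  (forall z, (x0 < z)%N -> ~~ occ eta z) -> (x0 <= L)%N ->
  Htrunc L r eta x = Hdual r eta x.
Proof.
move=> [x1 _] eta0; have QE z L' : (x0 <= L')%N -> (0 < z)%N ->
    Qtrunc L' r eta z = Qtrunc x0 r eta z.
  move=> /subnK <- z0; elim: (L' - x0)%N => // m <-.
  rewrite addSn; case: (leqP z (m + x0).+1) => zm; last first.
    by rewrite !Qtrunc_gt// ltnW.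
  rewrite /Qtrunc big_nat_recr//= /site_weight.
  by rewrite (negbTE (eta0 _ _)) ?mulr1// ltnS leq_addl.
move=> x0L; have := @Htrunc_cvg n eta x; apply: cvg_unique => //.
have E L' : (x0 <= L')%N -> Htrunc L' r eta x = Htrunc L r eta x.
  by move=> x0L'; apply: eq_bigr => i _; rewrite !QE.
apply/cvgrPdist_le => e e0; near=> L'.
by rewrite E ?subrr ?normr0 ?ltW//; near: L'; exact: nbhs_infty_ge.
Unshelve. all: by end_near. Qed.

End truncation_limit.

Lemma finitely_many_particles_bound (eta : config) : finitely_many_particles eta ->
  exists2 x0, (0 < x0)%N & forall z, (x0 < z)%N -> ~~ occ eta z.
Proof.
move=> /finite_seqP[s sE]; exists (\max_(z <- s) z).+1 => // z zs.
apply/negP => zeta; have : z \in s.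
  suff : [set` s] z by [].
  by rewrite -sE /= zeta andbT (leq_ltn_trans _ zs).
move=> /(@leq_bigmax_seq _ _ xpredT id z) /(_ isT) /=.
by rewrite leqNgt (ltnW zs).
Qed.

(** * Expectations along the process *)

Section expectation.
Variables (R : realType) (p q alpha gamma : R) (eta : config).
Variables (d : measure_display) (Omega : measurableType d) (P : probability Omega R).
Variable X : R -> Omega -> config.
Hypothesis aX : asep_process p q alpha gamma eta P X.

(** The event [X 0 = eta], as a countable intersection of occupation events, so that it is
    measurable and belongs to the past of time 0. *)
Let A0 : set Omega := \bigcap_i [set w | occ (X 0 w) i.+1 = occ eta i.+1].

Let occE (x : nat) : [set w | occ (X 0 w) x = occ eta x] =
  if occ eta x then [set w | occ (X 0 w) x] else ~` [set w | occ (X 0 w) x].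
Proof.
apply/seteqP; split=> w /=; case: (occ eta x) => //=.
- by move=> ->.
- by move/negP/negbTE.
Qed.

Let A0_past : past X 0 A0.
Proof.
rewrite /past; set G := (X in <<s X >>).
apply: (@bigcapT_measurable _ (g_sigma_algebraType G)) => i; rewrite occE.
have mG : (@measurable _ (g_sigma_algebraType G)) [set w | occ (X 0 w) i.+1].
  by apply: sub_sigma_algebra; exists 0, i.+1; rewrite lexx.
by case: ifP => _ //; exact: measurableC.
Qed.

Let A0_measurable : measurable A0.
Proof.
apply: bigcapT_measurable => i; rewrite occE.
have mX := asep_measurable aX (lexx 0) (ltn0Sn i).
by case: ifP => _ //; exact: measurableC.
Qed.

Let A0P w : A0 w <-> X 0 w = eta.
Proof.
split=> [Aw|Xw i _ /=]; last by rewrite Xw.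
by apply/funext => i; exact: Aw i I.
Qed.

Let A0C : P (~` A0) = 0%E.
Proof.
apply/negligibleP; first exact: measurableC.
apply: negligibleS (asep_start aX) => w /=; apply: contra_not => Xw; exact/A0P.
Qed.

(** The Markov property is applied at time 0 on the almost sure event [A0], where [S t f (X 0 w)] is
    constant. *)
Lemma asep_expectation : exists2 S, asep_semigroup p q alpha gamma S &
  forall (t : R) (f : config -> R), 0 <= t -> continuous f -> (forall xi, 0 <= f xi) ->
    measurable_fun setT (fun w => f (X t w)) ->
    (\int[P]_w (f (X t w))%:E = (S t f eta)%:E)%E.
Proof.
have [S [aS SX]] := asep_markov aX; exists S => // t f t0 cf f0 mf.
have {SX} := SX 0 t f A0 (lexx 0) t0 cf A0_past; rewrite add0r => SX.
have PA0 : P A0 = 1%E.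
  have := probability_setC P A0_measurable; rewrite A0C.
  by move/esym/eqP; rewrite sube_eq ?add0e// => /eqP.
rewrite (@ge0_negligible_integral _ _ _ P _ (~` A0)) //;
  [|exact: measurableC|exact/measurable_EFinP|].
  rewrite setTD setCK SX (eq_integral (cst (S t f eta)%:E)); last first.
    by move=> w /set_mem /A0P ->.
  by rewrite integral_cst// [X in (_ * X)%E](_ : _ = 1%E) ?mule1//; exact: PA0.
by move=> w _; rewrite lee_fin.
Qed.

Lemma measurable_Htrunc (n L : nat) (r t : R) (x : {ffun 'I_n -> nat}) : 0 <= t ->
  weyl x -> measurable_fun setT (fun w => Htrunc L r (X t w) x).
Proof.
move=> t0 [x1 _]; apply: measurable_prod => i _.
apply: measurable_prod => k; rewrite mem_index_iota => /andP[xk _].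
apply: measurable_fun_ifT; [|exact: measurable_cst|exact: measurable_cst].
apply: (measurable_fun_bool true).
rewrite setTI (_ : _ @^-1` _ = [set w | occ (X t w) k])//.
have k0 : (1 <= k)%N := leq_trans (x1 i) xk.
have h := asep_measurable aX t0 k0.
exact: h.
Qed.

End expectation.

(** * Convergence of the truncated expectations to the solution *)

Section semigroup_duality.
Variables (R : realType) (p q alpha gamma : R) (n : nat) (eta : config).
Hypotheses (q_gt0 : 0 < q) (q_lt_p : q < p)
  (liggett : alpha / p + gamma / q = 1).
Hypothesis eta_fin : finitely_many_particles eta.

Local Notation r := (q / p).
Local Notation rho := (alpha / p).

Let p_gt0 : 0 < p. Proof. exact: lt_trans q_lt_p. Qed.

Lemma Htrunc_continuous L (x : {ffun 'I_n -> nat}) :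
  continuous (fun xi => Htrunc L r xi x).
Proof.
(* Coordinates outside the chamber are included. Index 0 reads the same variable as site 1, so
   [L.+1] sites are used to contain site 1 even for [L = 0]. *)
apply: (@depends_on_first_continuous _ L.+1) => xi zeta ez.
apply: eq_bigr => i _; apply: eq_big_nat => -[|k] /andP[_ kL].
  by rewrite /site_weight (_ : occ xi 0 = occ xi 1)// ez.
by rewrite /site_weight ez//=; exact: ltnW.
Qed.

(** The truncated expectation minus [u] solves the evolution equation with an error governed by the
    occupation of [L] and [L.+1], which is factorially small. *)
Lemma semigroup_Htrunc_cvg (S : R -> (config -> R) -> config -> R)
    (u : R -> {ffun 'I_n -> nat} -> R) (t : R) (x : {ffun 'I_n -> nat}) :
  asep_semigroup p q alpha gamma S -> solution p q rho eta u ->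
  0 <= t -> weyl x ->
  S t (fun xi => Htrunc L r xi x) eta @[L --> \oo] --> u t x.
Proof.
move=> aS [ud ug u0] t0 wx; have [markovS _] := aS.
have [x0 x00 eta0] := finitely_many_particles_bound eta_fin.
have T0 : 0 < t + 1 by rewrite ltr_wpDl.
set T := t + 1 in T0 *; have [c [C [c0 C0 uC]]] := ug _ T0.
pose v L (s : R) (y : {ffun 'I_n -> nat}) := S s (fun xi => Htrunc L r xi y) eta.
pose a := p + n%:R * (p - q); pose K := Dgen_norm p q rho n * expR c.
have a0 : 0 <= a by rewrite addr_ge0 ?(ltW p_gt0)// mulr_ge0// subr_ge0 ltW.
pose E k := ((p + q) * T) ^+ k / k`!%:R.
have E0 k : 0 <= E k.
  by rewrite divr_ge0// exprn_ge0// mulr_ge0 ?addr_ge0// ltW.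
(* [Dgen] acts on the coordinates and [S s] on the configuration, so they commute. *)
have vE L (s : R) y : 0 <= s -> Dgen p q rho (v L s) y =
    S s (fun xi => Dgen p q rho (Htrunc L r xi) y) eta.
  move=> s0; have [_ ->//] := semigroup_combination markovS
    (F := fun xi => Htrunc L r xi) eta (Dgen_combination p q rho y) s0
    (@Htrunc_continuous L).
have Dcont L (y : {ffun 'I_n -> nat}) : continuous (fun xi => Dgen p q rho (Htrunc L r xi) y).
  by have [] := semigroup_combination markovS
    (F := fun xi => Htrunc L r xi) eta (Dgen_combination p q rho y) (lexx 0)
    (@Htrunc_continuous L).
have bound k : `|v (k + x0.+1)%N t x - u t x| <=
    (a + q) * E k / K * (expR (K * t) - 1) * weight c x.
  (* This [L] lies more than [k] sites beyond [x0], so occupation of [L] and [L.+1] is bounded by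
     [E k]. *)
  set L := (k + x0.+1)%N; have L0 : (0 < L)%N by rewrite /L addnS.
  have L_k : (x0 + k < L)%N by rewrite /L addnS addnC.
  pose err (s : R) (y : {ffun 'I_n -> nat}) := S s (asep_L p q alpha gamma (fun xi => Htrunc L r xi y)) eta
    - Dgen p q rho (v L s) y.
  (* The a priori constant adds 1 for the truncated expectation and [C] for [u]. *)
  apply: (@evolution_perturbation _ p q rho n (ltW p_gt0) (ltW q_gt0)
    (fun s y => v L s y - u s y) err c (1 + C) ((a + q) * E k) T) => //.
  - exact: ltW.
  - by rewrite addr_ge0 ?ltW.
  - by rewrite mulr_ge0 ?E0// addr_ge0// ltW.
  - move=> s y /andP[s0 _] wy; rewrite DgenB /err.
    have cancel (b e f : R) : b - e + (f - b) = f - e by ring.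
    rewrite cancel; apply: derive_nonnegB; last exact: ud.
    exact: (asep_derive (eta := eta) aS s0 (Htrunc_depends (L := L) r wy)).
  - move=> s y /andP[s0 sT] wy; rewrite /err vE// addrC -mulN1r.
    have cL := depends_on_first_continuous (asep_L_depends p q alpha gamma
      (Htrunc_depends (L := L) r wy)).
    rewrite -(semigroupE markovS)//.
    have cocc z : (0 < z)%N -> continuous (fun xi : config => (occ xi z)%:R : R).
      by move=> z0; exact: depends_on_first_continuous (@occ_depends R z z0).
    pose g2 (xi : config) : R := q * (occ xi L.+1)%:R + 0.
    pose g (xi : config) : R := a * (occ xi L)%:R + g2 xi.
    have cg2 : continuous g2.
      by apply: continuous_comb; [exact: cocc|exact: continuous_cst_config].
    have cg : continuous g by apply: continuous_comb; [exact: cocc|exact: cg2].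
    apply: (@le_trans _ _ (S s g eta)).
      apply: semigroup_dominated => //; first exact: continuous_comb.
      move=> xi; rewrite mulN1r addrC /g /g2 addr0.
      exact: truncated_duality.
    rewrite /g semigroupE//; last exact: cocc.
    rewrite /g2 semigroupE//; [|exact: cocc|exact: continuous_cst_config].
    rewrite semigroup_cst// addr0 [leRHS]mulrDl.
    have occE z : (x0 + k < z)%N -> S s (fun xi => (occ xi z)%:R) eta <= E k.
      move=> zk; apply: le_trans (asep_occ_le (ltW p_gt0) (ltW q_gt0) aS x00 eta0 zk s0) _.
      have pq0 : 0 <= p + q by rewrite addr_ge0// ltW.
      by rewrite ler_wpM2r// lerXn2r ?nnegrE ?mulr_ge0 ?(ltW T0)// ler_wpM2l.
    apply: lerD; first by rewrite ler_wpM2l// occE.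
    by rewrite ler_wpM2l ?(ltW q_gt0)// occE// ltnW.
  - move=> s y sT wy; have /andP[s0 _] := sT.
    apply: le_trans (ler_normB _ _) _; rewrite mulrDl lerD//; last exact: uC.
    rewrite mul1r; apply: (@le_trans _ _ 1); last by rewrite weight_ge1// ltW.
    apply: semigroup_norm_le => //; first exact: Htrunc_continuous.
    move=> xi; have /andP[H0 H1] := Htrunc_itv L q_gt0 q_lt_p xi y.
    by rewrite ger0_norm.
  (* As [L] exceeds [x0], truncation does not change the initial value. *)
  - move=> y wy; rewrite /v (semigroup0 markovS); last exact: Htrunc_continuous.
    have r_gt0 : 0 < r by exact: divr_gt0.
    have r_lt1 : r < 1 by rewrite ltr_pdivrMr// mul1r.
    rewrite u0// (Htrunc_eventually r_gt0 r_lt1 wy eta0) ?subrr//.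
    by rewrite /L addnS ltnW// ltnS leq_addl.
  - by rewrite t0 lerDl ler01.
rewrite -(cvg_shiftn x0.+1).
have bound0 : (a + q) * E k / K * (expR (K * t) - 1) * weight c x @[k --> \oo] --> (0 : R).
  rewrite [X in _ --> X](_ : _ = (a + q) * 0 / K * (expR (K * t) - 1) * weight c x);
    last by rewrite mulr0 !mul0r.
  by do 3 apply: cvgMl; apply: cvgMr; exact: cvg_expr_fact.
apply/cvgrPdist_le => e e0; move/cvgrPdist_le: bound0 => /(_ e e0).
apply: filterS => k; rewrite sub0r normrN distrC; apply: le_trans.
exact: le_trans (bound k) (ler_norm _).
Qed.

End semigroup_duality.

(** * Well-posedness and the probabilistic representation *)

Unset Implicit Arguments.

Theorem proposition2p9 (R : realType) (p q alpha gamma : R) (n : nat)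
    (eta : config)
    (q_gt0 : 0 < q) (q_lt_p : q < p) (alpha_ge0 : 0 <= alpha)
    (gamma_ge0 : 0 <= gamma) (liggett : alpha / p + gamma / q = 1)
    (n_ge1 : (1 <= n)%N) (eta_fin : finitely_many_particles eta) :
  exists u : R -> {ffun 'I_n -> nat} -> R,
    [/\ solution p q (alpha / p) eta u,
        (forall v : R -> {ffun 'I_n -> nat} -> R,
          solution p q (alpha / p) eta v ->
          forall t x, 0 <= t -> weyl x -> v t x = u t x)
      & (forall (d : measure_display) (Omega : measurableType d)
          (P : probability Omega R) (X : R -> Omega -> config),
          asep_process p q alpha gamma eta P X ->
          forall t x, 0 <= t -> weyl x ->
          (u t x)%:E = 'E_P[fun w => Hdual (q / p) (X t w) x]%E)].
Proof.
have p_gt0 : 0 < p by exact: lt_trans q_lt_p.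
have r_gt0 : 0 < q / p by exact: divr_gt0.
have r_lt1 : q / p < 1 by rewrite ltr_pdivrMr// mul1r.
(* The bound passes to the limit from the truncations. *)
have H_le1 (x : {ffun 'I_n -> nat}) : `|Hdual (q / p) eta x| <= 1.
  apply: (cvgr_to_le (cvg_norm (@Htrunc_cvg _ _ r_gt0 r_lt1 n eta x))).
  apply: nearW => L; have /andP[H0 H1] := Htrunc_itv L q_gt0 q_lt_p eta x.
  by rewrite ger0_norm.
pose u := exp_Dgen p q (alpha / p) (n := n) (Hdual (q / p) eta).
have usol : solution p q (alpha / p) eta u.
  by apply: exp_Dgen_solution => //; exact: ltW.
exists u; split => // [v vsol t x t0 wx|d Omega P X aX t x t0 wx].
  by apply: (solution_unique _ _ usol vsol) => //; exact: ltW.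
have [S aS SE] := asep_expectation aX.
have vu := semigroup_Htrunc_cvg q_gt0 q_lt_p liggett eta_fin aS usol t0 wx.
rewrite unlock.
have mHt L := measurable_Htrunc aX L (q / p) t0 wx.
have Hcvg w : Htrunc L (q / p) (X t w) x @[L --> \oo] --> Hdual (q / p) (X t w) x.
  exact: Htrunc_cvg.
have mH : measurable_fun setT (fun w => Hdual (q / p) (X t w) x).
  by apply: (@measurable_fun_cvg _ _ _ _ (fun L w => Htrunc L (q / p) (X t w) x)) => // w _.
(* The truncations are bounded by 1, so their expectations converge to that of [Hdual]. *)
have [|||||_ _ dom] := @dominated_convergence _ _ _ P setT measurableT
  (fun L w => (Htrunc L (q / p) (X t w) x)%:E) (fun w => (Hdual (q / p) (X t w) x)%:E)
  (cst 1%E).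
- by move=> L; exact/measurable_EFinP.
- exact/measurable_EFinP.
- by apply: aeW => w _; apply: cvg_EFin; [exact: nearW|exact: Hcvg].
- exact: finite_measure_integrable_cst.
- apply: aeW => w L _ /=; rewrite lee_fin.
  have /andP[H0 H1] := Htrunc_itv L q_gt0 q_lt_p (X t w) x.
  by rewrite ger0_norm.
(* The same expectations are values of the semigroup, which converge to [u t x]; the two limits
   agree. *)
apply: (@cvg_unique _ (@ereal_hausdorff R) _ _ _ _ _ dom).
rewrite (_ : (fun L => _) = (fun L => (S t (fun xi => Htrunc L (q / p) xi x) eta)%:E)).
  by apply: cvg_EFin; [exact: nearW|exact: vu].
apply/funext => L; apply: SE => //; first exact: Htrunc_continuous.
by move=> xi; have /andP[] := Htrunc_itv L q_gt0 q_lt_p xi x.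
Qed.
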